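(* Let $Q$ be the linear graphon Hawkes birth-death process on $\mathscr X=[0,1]$ (started on an empty history) with parameters $\lambda_\infty,h,W,B$ and lifetimes $(J_x)_{x\in[0,1]}$ as described in the context. For $x\in[0,1]$ let $\eta_x$ be the Laplace functional of the cluster process $S_x$ generated by an arrival at $x$. Then, for all $t\ge0$ and all bounded measurable $f:[0,1]\to\mathbb R_+$, the Laplace functional of $Q$ satisfies $$\mathcal L_Q(f,t)=\exp\Big(\int_0^1\int_0^t\big(\eta_x(f,u)-1\big)\lambda_\infty(x)\,\mathrm du\,\mathrm dx\Big).$$
   Context: Parameters: $\lambda_\infty:[0,1]\to\mathbb R_+$ in $L^1[0,1]$; $h:\mathbb R_+\to\mathbb R_+$ in $L^1(\mathbb R_+)$; $W:[0,1]^2\to\mathbb R_+$ measurable; $B=(B_{xy})$ a nonnegative stochastic process on $[0,1]^2$, separable with respect to the open subsets of $[0,1]^2$; there are conjugate exponents $p,q\in[1,\infty]$ with $W(\cdot,y)\in L^p[0,1]$ and $\mathbb E[B_{\cdot y}]\in L^q[0,1]$ for a.e. $y$. $J=(J_x)_{x\in[0,1]}$ is an $\mathbb R_+$-valued stochastic process on $[0,1]$, separable with respect to the open subsets of $[0,1]$. Linear graphon Hawkes process $N$ (cluster representation): immigrants arrive according to a Poisson process on $[0,\infty)\times[0,1]$ with intensity $\lambda_\infty(x)\,\mathrm dt\,\mathrm dx$; every event (immigrant or offspring) at time $s$ and location $y$ carries an independent realization $B(s)$ of $B$ and generates next-generation offspring according to a Poisson process on $[s,\infty)\times[0,1]$ with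 intensity $B_{xy}(s)W(x,y)h(t-s)\,\mathrm dt\,\mathrm dx$. $N$ is the collection of all events. Birth-death process $Q$: each event $(t',x)$ of $N$ has a lifetime $w_{t',x}$ distributed as $J_x$, independent of everything else; $Q(t)$ is the collection of (locations of) events with $t'\le t<t'+w_{t',x}$, and $Q_t(A)$ counts those with location in $A$. Death does not affect the generation of offspring. Cluster process $S_x$: the collection, at time $u$ after an arrival at $x$, of all events in the cluster of that arrival (the arrival itself included) that have occurred and whose lifetime has not yet expired. Laplace functionals: for such a process $Z$, $\mathcal L_Z(f,t)=\mathbb E\big[\exp\big(-\sum_{x_i\in Z(t)}f(x_i)\big)\big]$, where the sum is over the locations of the events that have occurred and not yet expired at time $t$; $\eta_x(f,u):=\mathcal L_{S_x}(f,u)$. *)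

(* Defs.v *)
From HB Require Import structures.
From mathcomp Require Export all_boot all_order all_algebra.
From mathcomp Require Export all_classical all_reals all_analysis.
From mathcomp Require Export measurable_realfun.

#[export] Set Implicit Arguments.
#[export] Unset Strict Implicit.
#[export] Unset Printing Implicit Defensive.

Export Order.TTheory GRing.Theory Num.Theory.
Export numFieldNormedType.Exports.

Local Open Scope classical_set_scope.
Local Open Scope ring_scope.
Local Open Scope ereal_scope.

Notation leb R := (@lebesgue_measure R) (only parsing).

Definition I01 {R : realType} : set R := [set` `[0%R, 1%R]].

(* Doob separability of the real process (X v) indexed by I, relative to the
   open subsets of I: events constraining X over the trace on I of an open set
   can be decided, up to one null set, on a countable dense subset D of I. *)
Definition separable_process {R : realType} {d} {T : measurableType d}
    {V : topologicalType} (P : probability T R) (I : set V)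
    (X : V -> T -> R) : Prop :=
  exists (D : set V) (Z : set T),
    [/\ countable D, D `<=` I, I `<=` closure D, P.-negligible Z &
      forall (G : set V) (F : set R), open G -> closed F ->
        [set w | forall v, (G `&` D) v -> F (X v w)] `\`
        [set w | forall v, (G `&` I) v -> F (X v w)] `<=` Z].

(* Probability that a Poisson variable of mean m in [0, +oo] equals n; the
   mean +oo corresponds to a variable that is almost surely infinite.
   [poisson_prob] ignores its second argument; its point masses are used
   rather than [poisson_pmf], which is constantly 1 at rate 0. *)
Definition poisson_mass {R : realType} (m : \bar R) (n : nat) : \bar R :=
  if m is r%:E then poisson_prob r 0%N [set n] else 0.

(* Given the sigma-algebra F, the point processes N i for i in I (N i w C is
   the number of points in C) are independent Poisson processes with the
   F-conditional intensity measures nu i. *)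
Definition poisson_given {R : realType} {d} {T : measurableType d} {dE}
    {E : measurableType dE} (P : probability T R) (F : set (set T))
    {L : Type} (I : set L) (N nu : L -> T -> set E -> \bar R) : Prop :=
  forall A, F A ->
  forall (m : nat) (i : 'I_m -> L) (C : 'I_m -> set E) (k : 'I_m -> nat),
    (forall a, I (i a)) -> (forall a, measurable (C a)) ->
    (forall a b, a != b -> i a = i b -> C a `&` C b = set0) ->
    P (A `&` [set w | forall a, N (i a) w (C a) = (k a)%:R%:E]) =
    \int[P]_(w in A) \prod_(a < m) poisson_mass (nu (i a) w (C a)) (k a).

(* Events are labelled by words (Ulam-Harris): the potential children of the
   event u are the rcons u i, and born u says whether u actually occurs; the
   other fields are meaningless for labels that do not occur.
   The word [::] is the initial arrival of a cluster; for the Hawkes process it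
   is never born, and the words of size 1 label the immigrants.
   Marks live in a probability space M carrying the process B, so that an event
   with mark m carries the realization B m. *)
Record events {dT dM} (T : measurableType dT) (M : measurableType dM)
    (R : realType) := Events {
  born : seq nat -> {mfun T >-> bool} ;
  time : seq nat -> {mfun T >-> R} ;
  loc  : seq nat -> {mfun T >-> R} ;
  mark : seq nat -> {mfun T >-> M} ;
  life : seq nat -> {mfun T >-> R} ;
  loc_I01 : forall u w, born u w -> I01 (loc u w) }.

Section hawkes.
Context {R : realType} {dT dM : measure_display} {T : measurableType dT}
  {M : measurableType dM}.
Implicit Types (P : probability T R) (E : events T M R).

Definition generated_by {d'} {T' : measurableType d'} (X : T -> T') :
  set (set T) := preimage_set_system setT X measurable.

(* sigma-algebra of the births, times and locations of the labels in U and of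
   the marks of the labels in U' *)
Definition history E (U U' : set (seq nat)) : set (set T) :=
  <<s (\bigcup_(u in U) (generated_by (born E u) `|` generated_by (time E u)
                         `|` generated_by (loc E u)))
      `|` \bigcup_(u in U') generated_by (mark E u) >>.

Definition generation (n : nat) : set (seq nat) := [set u | size u = n].
Definition up_to (n : nat) : set (seq nat) := [set u | (size u <= n)%N].
Definition before (n : nat) : set (seq nat) := [set u | (size u < n)%N].

(* The marks of the n-th generation events are independent realizations of the
   mark, independent of the genealogy up to generation n. *)
Definition independent_marks P (PB : probability M R) E : Prop :=
  forall (n : nat) (A : set T) (s : seq (seq nat)) (C : seq nat -> set M),
    history E (up_to n) (before n) A ->
    uniq s -> {in s, forall u, generation n u} ->
    (forall w, A w -> {in s, forall u, born E u w}) ->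
    (forall u, measurable (C u)) ->
    P (A `&` [set w | {in s, forall u, C u (mark E u w)}]) =
    P A * \prod_(u <- s) PB (C u).

(* Given all births, times, locations and marks, the lifetimes of the events
   are independent, that of an event at x having the law of J x. *)
Definition independent_lifetimes P {dJ} {V : measurableType dJ}
    (PJ : probability V R) (J : R -> V -> R) E : Prop :=
  forall (A : set T) (s : seq (seq nat)) (C : seq nat -> set R),
    history E setT setT A -> uniq s ->
    (forall w, A w -> {in s, forall u, born E u w}) ->
    (forall u, measurable (C u)) ->
    P (A `&` [set w | {in s, forall u, C u (life E u w)}]) =
    \int[P]_(w in A) \prod_(u <- s) PJ (J (loc E u w) @^-1` C u).

Definition offspring E (u : seq nat) (w : T) (C : set (R * R)) : \bar R :=
  \esum_(i in [set i : nat | born E (rcons u i) w /\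
                 C (time E (rcons u i) w, loc E (rcons u i) w)]) 1.

(* Points of R * R are (time, location). *)
Definition immigrant_intensity (lam : R -> R) (C : set (R * R)) : \bar R :=
  \int[leb R \x leb R]_(z in C `&` ([set` `[0%R, +oo[] `*` I01)) (lam z.2)%:E.

Definition offspring_intensity (h : R -> R) (W : R -> R -> R)
    (B : M -> R -> R -> R) E (u : seq nat) (w : T) (C : set (R * R)) : \bar R :=
  let s := time E u w in let y := loc E u w in
  if born E u w then
    \int[leb R \x leb R]_(z in C `&` ([set` `[s, +oo[] `*` I01))
      (B (mark E u w) z.2 y * W z.2 y * h (z.1 - s))%:E
  else 0.

Definition reproduces P E (nu : seq nat -> T -> set (R * R) -> \bar R) : Prop :=
  forall n, poisson_given P (history E (up_to n) (up_to n)) (generation n)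
              (offspring E) nu.

Definition hawkes_process P (PB : probability M R) {dJ} {V : measurableType dJ}
    (PJ : probability V R) (lam h : R -> R) (W : R -> R -> R)
    (B : M -> R -> R -> R) (J : R -> V -> R) E : Prop :=
  [/\ forall w, born E [::] w = false,
      reproduces P E (fun u w => if u is [::] then immigrant_intensity lam
                                 else offspring_intensity h W B E u w),
      independent_marks P PB E &
      independent_lifetimes P PJ J E].

(* cluster of an arrival at location x and time 0 *)
Definition cluster_process P (PB : probability M R)
    {dJ} {V : measurableType dJ} (PJ : probability V R) (h : R -> R)
    (W : R -> R -> R) (B : M -> R -> R -> R) (J : R -> V -> R) (x : R) E :
    Prop :=
  [/\ forall w, [/\ born E [::] w, time E [::] w = 0%R & loc E [::] w = x],
      reproduces P E (offspring_intensity h W B E),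
      independent_marks P PB E &
      independent_lifetimes P PJ J E].

Definition alive E (t : R) (w : T) : set (seq nat) :=
  [set u | born E u w /\ (time E u w <= t < time E u w + life E u w)%R].

Definition laplace P E (f : R -> R) (t : R) : \bar R :=
  \int[P]_w expeR (- \esum_(u in alive E t w) (f (loc E u w))%:E).

End hawkes.

(* Main.v *)
(* Conditionally on the births, times, locations and marks, the lifetimes are
   independent, so a Laplace functional is the expectation of the product of
   survival (t - time, location) over the born labels. The product is first
   restricted to the words of length at most n, and the generations are then
   removed starting from the last one: the Laplace functional of the Poisson
   offspring processes followed by an integration over the independent marks
   replaces a factor G carried by the generation k + 1 by the factor
   generation_step G carried by the generation k. Hence the truncated functional
   of the cluster of x at time u is the n-th iterate G_n (u, x), while that of the
   Hawkes process, whose first generation is the Poisson process of immigrants,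
   is exp (- int int (1 - G_n (t - s, x)) lam x ds dx). The sequence G_n is
   nonincreasing, and its limit gives both sides of the identity. *)

From HB Require Import structures.
From mathcomp Require Import finmap ring lra.
Require Import Defs.

Local Open Scope classical_set_scope.
Local Open Scope ring_scope.
Local Open Scope ereal_scope.

(** * Exponential and logarithm on the extended real line *)

Section expeR_extra.
Context {R : realType}.
Implicit Types x y : \bar R.

(** The Hawkes process and the clusters live on unrelated probability spaces, so the process is not
    cut into clusters: each side is reduced to the same deterministic iterates, and only these are
    compared. The recursion runs backwards because the hypotheses describe a generation given the
    earlier ones; it therefore needs a last generation, which the bound on the length of the words
    provides. Poisson offspring, marks and lifetimes are known only through probabilities of events
    about finitely many labels. Passing from these to Laplace functionals is the bulk of the work:
    from sets to simple functions, then to measurable functions, then from finite to countable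
    families of labels. The independence of marks and lifetimes is moreover stated only on events
    where the labels concerned are born, so the factors are arranged to equal 1 at an unborn label.
    As far as the argument goes, infinitely many events may be alive. Sums are taken in [0, +oo] and
    exponentials in [0, 1], with exp (-oo) = 0, so that limits are either monotone or bounded by
    1. *)

Lemma expeRN_le1 x : 0 <= x -> expeR (- x) <= 1.
Proof. by move=> x0; rewrite -expeR0 lee_expeR leeNl oppe0. Qed.

Lemma expeRN_sum (I : eqType) (s : seq I) (x : I -> \bar R) :
  {in s, forall i, 0 <= x i} ->
  expeR (- \sum_(i <- s) x i) = \prod_(i <- s) expeR (- x i).
Proof.
elim: s => [|i s ih] x0; first by rewrite !big_nil oppe0 expeR0.
have xs0 : {in s, forall i, 0 <= x i}.
  by move=> j js; apply: x0; rewrite inE js orbT.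
have xi0 : 0 <= x i by apply: x0; rewrite mem_head.
rewrite !big_cons oppeD ?expeRD ?ih// ge0_adde_def ?inE//.
by rewrite big_seq; apply: sume_ge0 => j; exact: xs0.
Qed.

Lemma expeRND x y : 0 <= x -> 0 <= y ->
  expeR (- (x + y)) = expeR (- x) * expeR (- y).
Proof. by move=> x0 y0; rewrite oppeD ?expeRD// ge0_adde_def ?inE. Qed.

(** The value x = 0 is included: [lne] sends it to -oo, which [expeR] sends back to 0. Factors that
    vanish can thus be written as exponentials. *)
Lemma expeRN_lne x : 0 <= x -> expeR (- - lne x) = x.
Proof. by move=> x0; rewrite oppeK lneK// in_itv/= x0 leey. Qed.

Lemma lneN_ge0 x : x <= 1 -> 0 <= - lne x.
Proof. by rewrite oppe_ge0 lne_le0. Qed.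

Lemma measurable_expeR : measurable_fun [set: \bar R] (@expeR R).
Proof.
rewrite (_ : @expeR R = fun x => if x == +oo then +oo else
  if x == -oo then 0 else (expR (fine x))%:E); last first.
  by apply/funext => -[].
apply: measurable_fun_ifT => //; first exact: measurable_fun_eqe.
apply: measurable_fun_ifT => //; first exact: measurable_fun_eqe.
apply/measurable_EFinP; exact: measurableT_comp.
Qed.

Lemma measurable_lne : measurable_fun [set: \bar R] (@lne R).
Proof.
rewrite (_ : @lne R = fun x => if x == +oo then +oo else
  if x <= 0 then -oo else (ln (fine x))%:E); last first.
  by apply/funext => -[r| |] //=; rewrite ?leNye// (lee_fin r 0).
apply: measurable_fun_ifT => //; first exact: measurable_fun_eqe.
apply: measurable_fun_ifT => //; first exact: measurable_fun_lee.
apply/measurable_EFinP; exact: measurableT_comp.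
Qed.

(** The sequence decreases to its infimum, which has the form [expeR z] because [expeR] maps onto
    [0, +oo]. Comparing z with - x then uses the order alone and covers x = +oo. *)
Lemma cvg_expeRN (u : (\bar R)^nat) x : nondecreasing_seq u ->
  u @ \oo --> x -> expeR (- u n) @[n --> \oo] --> expeR (- x).
Proof.
move=> ndu ux.
have xE : x = ereal_sup (range u).
  by apply/esym/(cvg_unique _ (ereal_nondecreasing_cvgn ndu)).
have niu : nonincreasing_seq (fun n => expeR (- u n)).
  by move=> m n mn; rewrite lee_expeR leeN2; exact: ndu.
suff -> : expeR (- x) = ereal_inf (range (fun n => expeR (- u n))).
  exact: ereal_nonincreasing_cvgn.
apply/eqP; rewrite eq_le; apply/andP; split.
  apply: le_ereal_inf_tmp => _ [n _ <-]; rewrite lee_expeR leeN2 xE.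
  by apply: ereal_sup_ubound; exists n.
rewrite leNgt; apply/negP => xlt.
have y0 : 0 <= ereal_inf (range (fun n => expeR (- u n))).
  by apply: le_ereal_inf_tmp => _ [n _ <-]; exact: expeR_ge0.
move: xlt; have [z zE] := expeR_total y0; rewrite -zE lte_expeR lteNl.
rewrite xE => /ereal_sup_gt[_ [n _ <-]]; rewrite lteNl -lte_expeR zE.
by apply/negP; rewrite -leNgt; apply: ereal_inf_lbound; exists n.
Qed.

End expeR_extra.

(** * Finite products and sums of extended real functions *)

Section prode.
Context {R : realDomainType}.

Lemma prode_itv01 (I : eqType) (s : seq I) (x : I -> \bar R) :
  {in s, forall i, 0 <= x i <= 1} -> 0 <= \prod_(i <- s) x i <= 1.
Proof.
elim: s => [|i s ih] h; first by rewrite big_nil lee01 lexx.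
have /andP[i0 i1] := h i (mem_head _ _).
have /andP[s0 s1] : 0 <= \prod_(i <- s) x i <= 1.
  by apply: ih => j js; apply: h; rewrite inE js orbT.
rewrite big_cons mule_ge0//= -[leRHS]mule1.
exact: lee_pmul.
Qed.

End prode.

Section emeasurable_big.
Context d (T : measurableType d) (R : realType).

Lemma emeasurable_prod (D : set T) (I : eqType) (s : seq I)
    (h : I -> T -> \bar R) :
  {in s, forall i, measurable_fun D (h i)} ->
  measurable_fun D (fun x => \prod_(i <- s) h i x).
Proof.
elim: s => [|i s ih] mh.
  by under eq_fun do rewrite big_nil; exact: measurable_cst.
under eq_fun do rewrite big_cons.
apply: emeasurable_funM; first by apply: mh; rewrite mem_head.
by apply: ih => j js; apply: mh; rewrite inE js orbT.
Qed.

Lemma emeasurable_sum_in (D : set T) (I : eqType) (s : seq I)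
    (h : I -> T -> \bar R) :
  {in s, forall i, measurable_fun D (h i)} ->
  measurable_fun D (fun x => \sum_(i <- s) h i x).
Proof.
elim: s => [|i s ih] mh.
  by under eq_fun do rewrite big_nil; exact: measurable_cst.
under eq_fun do rewrite big_cons.
apply: emeasurable_funD; first by apply: mh; rewrite mem_head.
by apply: ih => j js; apply: mh; rewrite inE js orbT.
Qed.

End emeasurable_big.

(** * Joint laws and conditional independence *)

Section weighted_joint_law.
Context d d' dE (T : measurableType d) (T' : measurableType d')
  (E : measurableType dE) (R : realType) (P : {measure set T -> \bar R}).
Variables (p : T -> T') (K : R.-fker T ~> E) (W : T -> \bar R).

(* The law of (p w, e), where w has the density W with respect to P and e is
   drawn from K w. *)
Definition joint_law (mp : measurable_fun setT p) (mW : measurable_fun setT W)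
    (W0 : forall w, 0 <= W w) (Wfin : forall w, W w \is a fin_num) (D : set (T' * E)) : \bar R :=
  \int[P]_w (W w * \int[K w]_e (\1_D (p w, e))%:E).

Hypotheses (mp : measurable_fun setT p) (mW : measurable_fun setT W)
  (W0 : forall w, 0 <= W w) (Wfin : forall w, W w \is a fin_num).

Lemma measurable_fst_integral (k : T' * E -> \bar R) :
  (forall z, 0 <= k z) -> measurable_fun setT k ->
  measurable_fun setT (fun w => \int[K w]_e k (p w, e)).
Proof.
move=> k0 mk; apply: (measurable_fun_integral_finite_kernel
  (fun z : T * E => k (p z.1, z.2)) K) => //=.
apply: measurableT_comp => //; apply: measurable_fun_pair => //.
exact: measurableT_comp.
Qed.

Let measurable_sec (k : T' * E -> \bar R) w :
  measurable_fun setT k -> measurable_fun setT (fun e => k (p w, e)).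
Proof. by move=> mk; exact: measurableT_comp. Qed.

Let mindicE (D : set (T' * E)) : measurable D ->
  measurable_fun setT (fun z => (\1_D z)%:E : \bar R).
Proof. by move=> mD; exact/measurable_EFinP/measurable_indic. Qed.

Let joint_law0 : joint_law mp mW W0 Wfin set0 = 0.
Proof.
apply: integral0_eq => w _; rewrite integral0_eq ?mule0// => e _.
by rewrite indic0.
Qed.

Let joint_law_ge0 D : 0 <= joint_law mp mW W0 Wfin D.
Proof.
by apply: integral_ge0 => w _; rewrite mule_ge0// integral_ge0// => e _;
  rewrite lee_fin.
Qed.

Let joint_law_sigma_additive : semi_sigma_additive (joint_law mp mW W0 Wfin).
Proof.
move=> D mD tD mUD.
rewrite [X in _ --> X](_ : _ = \int[P]_w (\sum_(n <oo)
   (W w * \int[K w]_e (\1_(D n) (p w, e))%:E))); last first.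
  apply: eq_integral => w _.
  rewrite -(fineK (Wfin w)) nneseriesZl//; last first.
    by move=> n _; apply: integral_ge0 => e _; rewrite lee_fin.
  congr (_ * _); rewrite -integral_nneseries//; last first.
  - by move=> n; apply: (measurable_sec (k := EFin \o \1_(D n))); exact: mindicE.
  apply: eq_integral => e _.
  rewrite -[LHS]/(\d_(p w, e) (\bigcup_n D n)).
  exact/esym/cvg_lim/(@measure_semi_sigma_additive _ _ _ (\d_(p w, e))).
apply/cvg_closeP; split.
  by apply: is_cvg_nneseries => n _ _; exact: joint_law_ge0.
rewrite closeE// integral_nneseries//.
- move=> n; apply: emeasurable_funM => //.
  apply: (measurable_fst_integral (k := EFin \o \1_(D n))) => //.
    by move=> z; rewrite lee_fin.
  exact: mindicE.
- by move=> n w _; rewrite mule_ge0// integral_ge0.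
Qed.

HB.instance Definition _ := isMeasure.Build _ _ _ (joint_law mp mW W0 Wfin)
  joint_law0 joint_law_ge0 joint_law_sigma_additive.

Import HBNNSimple.

(** For indicators this is the definition of [joint_law]; nonnegative combinations give the simple
    functions, and monotone convergence, under the kernel as well as under both outer integrals,
    gives the general case. *)
Lemma integral_joint_law (k : T' * E -> \bar R) :
  (forall z, 0 <= k z) -> measurable_fun setT k ->
  \int[joint_law mp mW W0 Wfin]_z k z = \int[P]_w (W w * \int[K w]_e k (p w, e)).
Proof.
move=> k0 mk; pose h := nnsfun_approx measurableT mk.
have mh n : measurable_fun setT (fun z => (h n z)%:E).
  exact/measurable_EFinP.
have mhs n w : measurable_fun setT (fun e => (h n (p w, e))%:E).
  exact: (measurable_sec (k := fun z => (h n z)%:E)).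
have ndh m n z : (m <= n)%N -> (h m z)%:E <= (h n z)%:E.
  by move=> mn; rewrite lee_fin; exact/lefP/nd_nnsfun_approx.
have hk z : (h n z)%:E @[n --> \oo] --> k z by exact: cvg_nnsfun_approx.
have hE n : \int[joint_law mp mW W0 Wfin]_z (h n z)%:E =
    \int[P]_w (W w * \int[K w]_e (h n (p w, e))%:E).
  transitivity (\sum_(r \in range (h n))
     \int[P]_w (W w * \int[K w]_e (r * \1_(h n @^-1` [set r]) (p w, e))%:E)).
    rewrite integralT_nnsfun sintegralE; apply: eq_fsbigr => r _.
    have [r0|r0] := leP 0%R r; last first.
      rewrite preimage_nnfun0// measure0 mule0 integral0_eq// => w _.
      by rewrite integral0_eq ?mule0// => e _; rewrite indic0 mulr0.
    rewrite /= /joint_law -ge0_integralZl//; last 2 first.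
    - apply: emeasurable_funM => //.
      apply: (measurable_fst_integral
        (k := EFin \o \1_(h n @^-1` [set r]))) => //.
        by move=> z; rewrite lee_fin.
      exact: mindicE.
    - by move=> w _; rewrite mule_ge0// integral_ge0.
    apply: eq_integral => w _; rewrite muleCA; congr (_ * _).
    rewrite -ge0_integralZl//.
    - by apply: (measurable_sec (k := EFin \o \1_(h n @^-1` [set r])));
        exact: mindicE.
  have mr r : measurable_fun setT
      (fun z => (r * \1_(h n @^-1` [set r]) z)%:E : \bar R).
    by apply/measurable_EFinP/measurable_funM.
  have r_ge0 r z : 0 <= (r * \1_(h n @^-1` [set r]) z)%:E :> \bar R.
    by rewrite EFinM nnfun_muleindic_ge0.
  rewrite -ge0_integral_fsum//; last 2 first.
  - move=> r; apply: emeasurable_funM => //.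
    exact: (measurable_fst_integral
      (k := fun z => (r * \1_(h n @^-1` [set r]) z)%:E)).
  - by move=> r w _; rewrite mule_ge0// integral_ge0.
  apply: eq_integral => w _; rewrite -ge0_mule_fsumr//; last first.
    by move=> r; rewrite integral_ge0.
  congr (_ * _); rewrite -ge0_integral_fsum//.
  - by apply: eq_integral => e _; rewrite fsumEFin// -fimfunE.
  - move=> r.
    exact: (measurable_sec (k := fun z => (r * \1_(h n @^-1` [set r]) z)%:E)).
have c1 : \int[joint_law mp mW W0 Wfin]_z (h n z)%:E @[n --> \oo] -->
    \int[joint_law mp mW W0 Wfin]_z k z.
  rewrite [X in _ --> X](_ : _ =
      \int[joint_law mp mW W0 Wfin]_z limn (fun n => (h n z)%:E)).
    apply: cvg_monotone_convergence => //.
    - by move=> n z _; rewrite lee_fin.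
    - by move=> z _ m n; exact: ndh.
  by apply: eq_integral => z _; apply/esym/cvg_lim.
have ci w : \int[K w]_e (h n (p w, e))%:E @[n --> \oo] -->
    \int[K w]_e k (p w, e).
  rewrite [X in _ --> X](_ : _ =
      \int[K w]_e limn (fun n => (h n (p w, e))%:E)).
    apply: cvg_monotone_convergence => //.
    - by move=> n z _; rewrite lee_fin.
    - by move=> z _ m n; exact: ndh.
  by apply: eq_integral => z _; apply/esym/cvg_lim.
have iK0 n w : 0 <= \int[K w]_e (h n (p w, e))%:E.
  by apply: integral_ge0 => e _; rewrite lee_fin.
have ndi w m n : (m <= n)%N ->
    \int[K w]_e (h m (p w, e))%:E <= \int[K w]_e (h n (p w, e))%:E.
  move=> mn; apply: ge0_le_integral => //.
  - by move=> e _; rewrite lee_fin.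
  - by move=> e _; exact: ndh.
have c2 : \int[P]_w (W w * \int[K w]_e (h n (p w, e))%:E) @[n --> \oo] -->
    \int[P]_w (W w * \int[K w]_e k (p w, e)).
  rewrite [X in _ --> X](_ : _ = \int[P]_w
      limn (fun n => W w * \int[K w]_e (h n (p w, e))%:E)).
    apply: cvg_monotone_convergence => //.
    - move=> n; apply: emeasurable_funM => //.
      apply: (measurable_fst_integral (k := fun z => (h n z)%:E)) => //.
      by move=> z; rewrite lee_fin.
    - by move=> n w _; rewrite mule_ge0.
    - by move=> w _ m n mn; rewrite lee_wpmul2l// ndi.
  apply: eq_integral => w _; apply/esym/cvg_lim => //.
  by apply: cvgeZl => //; exact: ci.
rewrite (funext hE) in c1.
exact: (cvg_unique _ c1 c2).
Qed.

End weighted_joint_law.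

Section joint_law_unique.
Context d d' dE (T : measurableType d) (T' : measurableType d')
  (E : measurableType dE) (R : realType) (P : probability T R).
Variables (p : T -> T') (mp : measurable_fun setT p).
Variables (K1 K2 : R.-fker T ~> E) (W1 W2 : T -> \bar R).
Hypotheses (mW1 : measurable_fun setT W1) (mW2 : measurable_fun setT W2).
Hypotheses (W10 : forall w, 0 <= W1 w) (W20 : forall w, 0 <= W2 w).
Hypotheses (W11 : forall w, W1 w <= 1) (W21 : forall w, W2 w <= 1).
Hypothesis rectE : forall (A : set T') (C : set E),
  measurable A -> measurable C ->
  \int[P]_w (W1 w * (\1_A (p w))%:E * K1 w C) =
  \int[P]_w (W2 w * (\1_A (p w))%:E * K2 w C).
Hypothesis K1fin : forall w, K1 w setT <= 1.

(** Both sides are integrals of [k] against joint laws, which agree on rectangles by [rectE].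
    Rectangles form a pi-system generating the product sigma-algebra, and the first law is finite
    because its weight and its kernel are bounded by 1. *)
Lemma joint_law_unique (k : T' * E -> \bar R) :
  (forall z, 0 <= k z) -> measurable_fun setT k ->
  \int[P]_w (W1 w * \int[K1 w]_e k (p w, e)) =
  \int[P]_w (W2 w * \int[K2 w]_e k (p w, e)).
Proof.
move=> k0 mk.
have W1fin w : W1 w \is a fin_num.
  by rewrite ge0_fin_numE// (le_lt_trans (W11 w))// ltry.
have W2fin w : W2 w \is a fin_num.
  by rewrite ge0_fin_numE// (le_lt_trans (W21 w))// ltry.
apply: (etrans (esym (integral_joint_law P K1 mp mW1 W10 W1fin k0 mk))).
apply: (etrans _ (integral_joint_law P K2 mp mW2 W20 W2fin k0 mk)).
apply: eq_measure_integral => D mD _.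
have sectE (K : R.-fker T ~> E) w (A : set T') (C : set E) :
    measurable C ->
    \int[K w]_e (\1_(A `*` C) (p w, e))%:E = (\1_A (p w))%:E * K w C.
  move=> mC; under eq_integral do
    rewrite indicE in_setX/= -mulnb natrM -!indicE EFinM.
  rewrite ge0_integralZl//; last by apply/measurable_EFinP/measurable_indic.
  by rewrite integral_indic// setIT.
pose G := [set A `*` C | A in @measurable _ T' & C in @measurable _ E].
apply: (measure_unique G (fun=> setT)) => //.
- by rewrite measurable_prod_measurableType.
- move=> _ _ [A mA [C mC <-]] [A' mA' [C' mC' <-]].
  rewrite -setXI; exists (A `&` A'); first exact: measurableI.
  by exists (C `&` C') => //; exact: measurableI.
- by move=> n; exists setT => //; exists setT => //; rewrite setXTT.
- by rewrite bigcup_const//; exists 0%N.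
- move=> _ [A mA [C mC <-]].
  rewrite /= /joint_law.
  under eq_integral do rewrite sectE// muleA.
  by rewrite rectE//; apply: eq_integral => w _; rewrite sectE// muleA.
- move=> _; rewrite /= /joint_law.
  have KT w : \int[K1 w]_e (\1_[set: T' * E] (p w, e))%:E = K1 w setT.
    rewrite (eq_integral (cst 1)) ?integral_cst ?mul1e// => e _.
    by rewrite indicT.
  under eq_integral do rewrite KT.
  apply: (@le_lt_trans _ _ (\int[P]_w 1)).
    apply: ge0_le_integral => //.
    + by move=> w _; rewrite mule_ge0.
    + by apply: emeasurable_funM => //; exact: measurable_kernel.
    + by move=> w _; rewrite -[leRHS]mule1; apply: lee_pmul.
  by rewrite integral_cst// mul1e ltey_eq fin_num_measure.
Qed.

End joint_law_unique.

Section kernel_precomposition.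
Context d d' dE (T : measurableType d) (T' : measurableType d')
  (E : measurableType dE) (R : realType).
Variables (p : T -> T') (K : R.-pker T' ~> E).

(** The proof [mp] is an argument so that the kernel structures below, which depend on it, can be
    attached to the term. *)
Definition kpre (mp : measurable_fun setT p) (w : T) :
  {measure set E -> \bar R} := K (p w).

Hypothesis mp : measurable_fun setT p.

Let measurable_kpre U : measurable U -> measurable_fun setT (kpre mp ^~ U).
Proof.
move=> mU; apply: (measurableT_comp (f := fun x => K x U)) => //.
exact: measurable_kernel.
Qed.

HB.instance Definition _ := isKernel.Build _ _ _ _ _ (kpre mp) measurable_kpre.

Let kpre_prob w : kpre mp w setT = 1.
Proof. exact: prob_kernel. Qed.

HB.instance Definition _ :=
  Kernel_isProbability.Build _ _ _ _ _ (kpre mp) kpre_prob.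

End kernel_precomposition.

Section weighted_law_unique.
Context d d' (T : measurableType d) (T' : measurableType d') (R : realType)
  (P : probability T R).
Variables (p : T -> T') (mp : measurable_fun setT p) (X Y : T -> \bar R).
Hypotheses (mX : measurable_fun setT X) (mY : measurable_fun setT Y).
Hypotheses (X01 : forall w, 0 <= X w <= 1) (Y01 : forall w, 0 <= Y w <= 1).
Hypothesis XY : forall A : set T', measurable A ->
  \int[P]_(w in p @^-1` A) X w = \int[P]_(w in p @^-1` A) Y w.

(** The instance of [joint_law_unique] whose second coordinate lives in [unit]. The hypothesis [XY]
    says that X and Y have the same conditional expectation given [p], so any nonnegative weight
    depending on [p] alone may be inserted. *)
Lemma weighted_law_unique (H : T' -> \bar R) :
  (forall w, 0 <= H w) -> measurable_fun setT H ->
  \int[P]_w (X w * H (p w)) = \int[P]_w (Y w * H (p w)).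
Proof.
move=> H0 mH.
have mtt : measurable_fun [set: T] (fun _ : T => tt) by exact: measurable_cst.
pose K : R.-pker T ~> unit := kdirac mtt.
have KE (k : T' -> \bar R) w : measurable_fun setT k ->
    \int[K w]_e k (p w) = k (p w).
  by move=> mk; rewrite integral_dirac//= diracT mul1e.
have patchE (Z : T -> \bar R) (A : set T') :
    \int[P]_(w in p @^-1` A) Z w = \int[P]_w (Z w * (\1_A (p w))%:E).
  rewrite integral_mkcond; apply: eq_integral => w _.
  rewrite patchE indicE (_ : (w \in p @^-1` A) = (p w \in A)).
    by case: ifP => _; rewrite ?mule1 ?mule0.
  by apply/idP/idP; rewrite !inE.
have := @joint_law_unique _ _ _ _ _ _ _ P _ mp K K X Y mX mY.
have X0 w : 0 <= X w by have /andP[] := X01 w.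
have Y0 w : 0 <= Y w by have /andP[] := Y01 w.
move=> /(_ X0 Y0).
have X1 w : X w <= 1 by have /andP[] := X01 w.
have Y1 w : Y w <= 1 by have /andP[] := Y01 w.
move=> /(_ X1 Y1) /(_ _ _ (fun z => H z.1)) h.
transitivity (\int[P]_w (X w * \int[K w]_e H (p w))).
  by apply: eq_integral => w _; rewrite KE.
rewrite h//.
- by apply: eq_integral => w _; rewrite KE.
- move=> A C mA mC; rewrite /K /kdirac/= /dirac/=.
  have [Ct|Ct] := boolP (tt \in C).
    rewrite indicE Ct.
    under eq_integral do rewrite mule1.
    under [RHS]eq_integral do rewrite mule1.
    by rewrite -!patchE XY.
  rewrite indicE (negbTE Ct).
  by rewrite !integral0_eq// => w _; rewrite mule0.
- by move=> w; rewrite prob_kernel.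
- exact: measurableT_comp.
Qed.

End weighted_law_unique.

Lemma prod_indic (R : realType) (T : Type) (L : eqType) (s : seq L)
    (D : L -> set T) (w : T) :
  \prod_(u <- s) (\1_(D u) w)%:E =
  (\1_[set w | {in s, forall u, D u w}] w)%:E :> \bar R.
Proof.
elim: s => [|u s ih].
  by rewrite big_nil indicE mem_set.
rewrite big_cons ih !indicE -EFinM -natrM mulnb -in_setI; congr (_%:R%:E).
congr (nat_of_bool _); apply/idP/idP; rewrite !inE.
  by move=> -[Du Ds] v; rewrite inE => /predU1P[->//|]; exact: Ds.
move=> Ds; split; first by apply: Ds; rewrite mem_head.
by move=> v vs; apply: Ds; rewrite inE vs orbT.
Qed.

Lemma measurable_in_seq d (T : measurableType d) (L : eqType) (s : seq L)
    (D : L -> set T) : (forall u, measurable (D u)) ->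
  measurable [set w | {in s, forall u, D u w}].
Proof.
move=> mD; elim: s => [|u s ih].
  by rewrite (_ : [set _ | _] = setT)//; apply/seteqP; split.
rewrite (_ : [set _ | _] = D u `&` [set w | {in s, forall u, D u w}]).
  exact: measurableI.
apply/seteqP; split=> w /=.
  move=> Ds; split; first by apply: Ds; rewrite mem_head.
  by move=> v vs; apply: Ds; rewrite inE vs orbT.
by move=> -[Du Ds] v; rewrite inE => /predU1P[->//|]; exact: Ds.
Qed.

(** * Conditionally independent variables: from sets to functions *)

Section conditional_independence.
Context d d' dE (T : measurableType d) (T' : measurableType d')
  (E : measurableType dE) (R : realType) (P : probability T R).
Variables (p : T -> T') (mp : measurable_fun setT p).
Variables (L : eqType) (I : set L) (b : L -> set T').
Variables (Y : L -> T -> E) (K : L -> R.-pker T' ~> E).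
Hypotheses (mb : forall u, I u -> measurable (b u))
  (mY : forall u, measurable_fun setT (Y u)).
Hypothesis indep : forall (A : set T') (s : seq L) (C : L -> set E),
  measurable A -> uniq s -> {in s, forall u, I u} ->
  (forall w, A w -> {in s, forall u, b u w}) ->
  (forall u, measurable (C u)) ->
  P (p @^-1` A `&` [set w | {in s, forall u, C u (Y u w)}]) =
  \int[P]_(w in p @^-1` A) \prod_(u <- s) K u (p w) (C u).

Variable k : L -> T' * E -> \bar R.
Hypotheses (k01 : forall u z, 0 <= k u z <= 1)
  (mk : forall u, I u -> measurable_fun setT (k u))
  (kNb : forall u w e, ~ b u w -> k u (w, e) = 1).

Let k0 u z : 0 <= k u z. Proof. by have /andP[] := k01 u z. Qed.
Let k1 u z : k u z <= 1. Proof. by have /andP[] := k01 u z. Qed.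

Let kbar u w := \int[K u w]_e k u (w, e).

Let kbar01 u w : I u -> 0 <= kbar u w <= 1.
Proof.
move=> Iu; rewrite integral_ge0//=.
rewrite -(@prob_kernel _ _ _ _ _ (K u) w) -[leRHS]mul1e -integral_cst//.
by apply: ge0_le_integral => //; exact: measurableT_comp (mk Iu) _.
Qed.

Let mkbar u : I u -> measurable_fun setT (kbar u).
Proof.
move=> Iu.
exact: (measurable_fun_integral_finite_kernel (k u) (K u) (k0 u) (mk Iu)).
Qed.

(* The functions k are traded one label at a time for the indicators to which
   the independence hypothesis applies: s1 still carries functions, s2 sets. *)
Let cond_indep_rec s1 s2 (C : L -> set E) (H : T' -> \bar R) :
  uniq (s1 ++ s2) -> {in s1 ++ s2, forall u, I u} ->
  (forall u, measurable (C u)) ->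
  (forall w, 0 <= H w <= 1) -> measurable_fun setT H ->
  (forall w, H w != 0 -> {in s2, forall u, b u w}) ->
  \int[P]_w (H (p w) * \prod_(u <- s1) k u (p w, Y u w) *
             \prod_(u <- s2) (\1_(C u) (Y u w))%:E) =
  \int[P]_w (H (p w) * \prod_(u <- s1) kbar u (p w) *
             \prod_(u <- s2) K u (p w) (C u)).
Proof.
elim: s1 s2 C H => [|u s1 ih] s2 C H; rewrite ?cat0s => us sI mC H01 mH Hb.
  have H0 w : 0 <= H w by have /andP[] := H01 w.
  (* [indep] is available only on sets where every label of [s2] satisfies [b]. By [Hb] the set [B]
     is of this kind, and the weight vanishes outside it. *)
  pose B := [set w | H w != 0].
  have mB : measurable B.
    rewrite -[B]setTI; exact: (measurable_neqe measurableT mH (measurable_cst 0)).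
  pose X (Z : T -> \bar R) w := (\1_B (p w))%:E * Z w.
  have XE (Z : T -> \bar R) : \int[P]_w (H (p w) * Z w) =
      \int[P]_w (X Z w * H (p w)).
    apply: eq_integral => w _; rewrite /X.
    have [Hw|Hw] := eqVneq (H (p w)) 0; first by rewrite Hw mule0 mul0e.
    by rewrite indicE mem_set// mul1e muleC.
  have XA (Z : T -> \bar R) A : \int[P]_(w in p @^-1` A) X Z w =
      \int[P]_(w in p @^-1` (A `&` B)) Z w.
    rewrite integral_mkcond [RHS]integral_mkcond; apply: eq_integral => w _.
    rewrite !patchE /X indicE preimage_setI in_setI.
    rewrite (_ : (w \in p @^-1` B) = (p w \in B)); last first.
      by apply/idP/idP; rewrite !inE.
    by case: ifPn => //= _; case: ifPn => _; rewrite ?mul1e ?mul0e.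
  have mX (Z : T -> \bar R) : measurable_fun setT Z -> measurable_fun setT (X Z).
    move=> mZ; apply: emeasurable_funM => //; apply/measurable_EFinP.
    exact: measurableT_comp.
  have X01 (Z : T -> \bar R) : (forall w, 0 <= Z w <= 1) ->
      forall w, 0 <= X Z w <= 1.
    move=> Z01 w; have /andP[Z0 Z1] := Z01 w.
    rewrite mule_ge0 ?lee_fin//= -[leRHS]mule1; apply: lee_pmul => //.
    by rewrite lee_fin indicE; case: (_ \in _).
  under eq_integral do rewrite big_nil mule1.
  under [RHS]eq_integral do rewrite big_nil mule1.
  rewrite !XE; apply: (weighted_law_unique mp) => //.
  - apply: mX; apply: emeasurable_prod => v _; apply/measurable_EFinP.
    exact: measurableT_comp.
  - apply: mX; apply: emeasurable_prod => v _.
    apply: (measurableT_comp (f := fun w => K v w (C v))) => //.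
    exact: measurable_kernel.
  - apply: X01 => w; apply: prode_itv01 => v _.
    by rewrite !lee_fin indicE; case: (_ \in _); rewrite ?lexx ?ler01.
  - apply: X01 => w; apply: prode_itv01 => v _.
    by rewrite measure_ge0 -(@prob_kernel _ _ _ _ _ (K v) (p w)) le_measure ?inE.
  - move=> A mA; rewrite !XA -indep//; last 2 first.
    + exact: measurableI.
    + by move=> w [_ /Hb].
    rewrite (eq_integral (fun w =>
        (\1_[set w | {in s2, forall u, C u (Y u w)}] w)%:E)); last first.
      by move=> w _; exact: (prod_indic _ s2 (fun v => Y v @^-1` C v) w).
    rewrite integral_indic// 1?setIC//; last first.
      apply: (@measurable_in_seq _ _ _ s2 (fun v => Y v @^-1` C v)) => v.
      by rewrite -[X in measurable X]setTI; exact: mY.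
    rewrite -[X in measurable X]setTI; apply: mp => //; exact: measurableI.

have /andP[uNs us12] : (u \notin s1 ++ s2) && uniq (s1 ++ s2) by [].
have Iu : I u by apply: sI; rewrite mem_head.
have s12I : {in s1 ++ s2, forall v, I v}.
  by move=> v vs; apply: sI; rewrite inE vs orbT.
have s1I : {in s1, forall v, I v}.
  by move=> v vs; apply: s12I; rewrite mem_cat vs.
have mHb A : measurable A ->
    measurable_fun setT (fun w => H w * (\1_A w)%:E).
  by move=> mA; apply: emeasurable_funM => //; exact/measurable_EFinP.
have Hb01 A : forall w, 0 <= H w * (\1_A w)%:E <= 1.
  move=> w; have /andP[H0 H1] := H01 w.
  rewrite mule_ge0 ?lee_fin//= -[leRHS]mule1; apply: lee_pmul => //.
  by rewrite lee_fin indicE; case: (_ \in _).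
pose X1 w := \prod_(v <- s1) k v (p w, Y v w).
pose X2 w := \prod_(v <- s1) kbar v (p w).
pose C1 w := \prod_(v <- s2) (\1_(C v) (Y v w))%:E : \bar R.
pose C2 w := \prod_(v <- s2) K v (p w) (C v).
have mX1 : measurable_fun setT X1.
  apply: emeasurable_prod => v vs; apply: (measurableT_comp (f := k v)).
    by apply: mk; exact: s1I.
  exact: measurable_fun_pair.
have mX2 : measurable_fun setT X2.
  apply: emeasurable_prod => v vs.
  apply: (measurableT_comp (f := kbar v)) => //.
  by apply: mkbar; exact: s1I.
have mC1 : measurable_fun setT C1.
  apply: emeasurable_prod => v _; apply/measurable_EFinP.
  exact: measurableT_comp.
have mC2 : measurable_fun setT C2.
  apply: emeasurable_prod => v _.
  apply: (measurableT_comp (f := fun w => K v w (C v))) => //.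
  exact: measurable_kernel.
have X101 w : 0 <= X1 w <= 1 by apply: prode_itv01 => v _; exact: k01.
have X201 w : 0 <= X2 w <= 1.
  by apply: prode_itv01 => v vs; exact/kbar01/s1I.
have C101 w : 0 <= C1 w <= 1.
  apply: prode_itv01 => v _.
  by rewrite !lee_fin indicE; case: (_ \in _); rewrite ?lexx ?ler01.
have C201 w : 0 <= C2 w <= 1.
  apply: prode_itv01 => v _.
  by rewrite measure_ge0 -(@prob_kernel _ _ _ _ _ (K v) (p w)) le_measure ?inE.
have M01 (x y : \bar R) : 0 <= x <= 1 -> 0 <= y <= 1 -> 0 <= x * y <= 1.
  move=> /andP[x0 x1] /andP[y0 y1]; rewrite mule_ge0//= -[leRHS]mule1.
  exact: lee_pmul.
have mp_comp (h : T' -> \bar R) : measurable_fun setT h ->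
    measurable_fun setT (fun w => h (p w)).
  by move=> mh; exact: measurableT_comp.
(* Off [b u] the factor of [u] equals 1 and disappears; on [b u] it is kept. In both cases the
   indicator joins the weight [H]. *)
have splitE (Z U V : T -> \bar R) : measurable_fun setT Z ->
    measurable_fun setT U -> measurable_fun setT V ->
    (forall w, 0 <= Z w <= 1) -> (forall w, 0 <= U w <= 1) ->
    (forall w, 0 <= V w <= 1) -> (forall w, ~ b u (p w) -> Z w = 1) ->
    \int[P]_w (H (p w) * (Z w * U w) * V w) =
    \int[P]_w (H (p w) * (\1_(b u) (p w))%:E * U w * V w * Z w) +
    \int[P]_w (H (p w) * (\1_(~` b u) (p w))%:E * U w * V w).
  move=> mZ mU mV Z01 U01 V01 ZN; rewrite -ge0_integralD//.
  - apply: eq_integral => w _; rewrite !indicE in_setC.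
    have [bw|bw] := boolP (p w \in b u).
      by rewrite mule1 mule0 !mul0e adde0 !muleA; rewrite muleAC (muleAC _ (Z w)).
    rewrite mule0 !mul0e add0e ZN ?mul1e ?mule1//.
    by move: bw => /negP; rewrite inE.
  - move=> w _; have /andP[-> _] // := M01 _ _ (M01 _ _ (M01 _ _ (Hb01 (b u) (p w))
      (U01 w)) (V01 w)) (Z01 w).
  - do 3 (apply: emeasurable_funM => //).
    by apply: (mp_comp _ (mHb _ _)); exact: mb.
  - move=> w _; have /andP[-> _] // := M01 _ _ (M01 _ _ (Hb01 (~` b u) (p w))
      (U01 w)) (V01 w).
  - do 2 (apply: emeasurable_funM => //).
    by apply: (mp_comp _ (mHb _ _)); apply: measurableC; exact: mb.
under eq_integral do rewrite big_cons -/(X1 _) -/(C1 _).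
under [RHS]eq_integral do rewrite big_cons -/(X2 _) -/(C2 _).
rewrite (splitE (fun w => k u (p w, Y u w)))//; last 2 first.
- apply: (measurableT_comp (f := k u)); first exact: mk.
  exact: measurable_fun_pair.
- by move=> w; exact: kNb.
rewrite (splitE (fun w => kbar u (p w)))//; last 3 first.
- exact/mp_comp/mkbar.
- by move=> w; exact: kbar01.
- move=> w bw; rewrite /kbar (eq_integral (cst 1)).
    by rewrite integral_cst// mul1e prob_kernel.
  by move=> e _; exact: kNb.
congr (_ + _); last first.
  apply: (ih s2 C (fun w => H w * (\1_(~` b u) w)%:E)) => //.
    by apply: mHb; apply: measurableC; exact: mb.
  move=> w; have [->|Hw _] := eqVneq (H w) 0; first by rewrite mul0e eqxx.
  exact: Hb.
pose W1 w := H (p w) * (\1_(b u) (p w))%:E * X1 w * C1 w.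
pose W2 w := H (p w) * (\1_(b u) (p w))%:E * X2 w * C2 w.
have W101 w : 0 <= W1 w <= 1 by do 2 (apply: (M01) => //).
have W201 w : 0 <= W2 w <= 1 by do 2 (apply: (M01) => //).
have mW (U V : T -> \bar R) : measurable_fun setT U -> measurable_fun setT V ->
    measurable_fun setT (fun w => H (p w) * (\1_(b u) (p w))%:E * U w * V w).
  move=> mU mV; do 2 (apply: emeasurable_funM => //).
  by apply: (mp_comp _ (mHb _ _)); exact: mb.
have ge0 (W : T -> \bar R) : (forall w, 0 <= W w <= 1) -> forall w, 0 <= W w.
  by move=> W01 w; have /andP[] := W01 w.
have le1 (W : T -> \bar R) : (forall w, 0 <= W w <= 1) -> forall w, W w <= 1.
  by move=> W01 w; have /andP[] := W01 w.
(* On [b u] the two factors are integrals of [k u], against the Dirac mass at [Y u w] and against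
   [K u]. By [joint_law_unique] it suffices to treat a product of a set A of histories and a set B
   of values: A is absorbed by the weight, and the induction hypothesis applies with [u] moved to
   [s2], carrying the set B. *)
pose K1 : R.-fker T ~> E := kdirac (mY u).
pose K2 : R.-fker T ~> E := kpre (K u) mp.
transitivity (\int[P]_w (W1 w * \int[K1 w]_e k u (p w, e))).
  apply: eq_integral => w _; congr (_ * _).
  rewrite integral_dirac//= ?diracT ?mul1e//.
  by apply: measurableT_comp; [exact: mk|exact: pair1_measurable].
transitivity (\int[P]_w (W2 w * \int[K2 w]_e k u (p w, e))); last by [].
apply: (joint_law_unique mp) => //.
- exact: mW.
- exact: mW.
- exact: ge0.
- exact: ge0.
- exact: le1.
- exact: le1.
- move=> A B mA mB.
  pose C' v := if v == u then B else C v.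
  have C'E v : v \in s2 -> C' v = C v.
    rewrite /C'; case: eqP => // -> us2; move: uNs.
    by rewrite mem_cat us2 orbT.
  have := ih (u :: s2) C' (fun w => H w * (\1_(b u `&` A) w)%:E).
  have mem2 : s1 ++ u :: s2 =i u :: s1 ++ s2.
    by move=> v; rewrite !(mem_cat, inE) orbCA.
  have us2 : uniq (s1 ++ u :: s2) by rewrite -cat1s uniq_catCA.
  have sI2 : {in s1 ++ u :: s2, forall v, I v} by move=> v; rewrite mem2; exact: sI.
  have mC' v : measurable (C' v) by rewrite /C'; case: ifP.
  move=> /(_ us2 sI2 mC' (Hb01 _)).
  have Hb2 w : H w * (\1_(b u `&` A) w)%:E != 0 -> {in u :: s2, forall v, b v w}.
    have [->|Hw] := eqVneq (H w) 0; first by rewrite mul0e eqxx.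
    rewrite indicE in_setI; have [bw _ v|] := boolP (w \in b u).
      rewrite inE => /predU1P[->|]; first by rewrite -in_setE.
      exact: Hb.
    by rewrite mule0 eqxx.
  move=> /(_ (mHb _ (measurableI _ _ (mb Iu) mA)) Hb2).
  have E1 w : \prod_(v <- u :: s2) (\1_(C' v) (Y v w))%:E =
      \d_(Y u w) B * C1 w :> \bar R.
    rewrite big_cons /C' eqxx; congr (_ * _).
    by apply: eq_big_seq => v vs; rewrite -/(C' v) C'E.
  have E2 w : \prod_(v <- u :: s2) K v (p w) (C' v) = K u (p w) B * C2 w.
    rewrite big_cons /C' eqxx; congr (_ * _).
    by apply: eq_big_seq => v vs; rewrite -/(C' v) C'E.
  under eq_integral do rewrite E1 -/(X1 _).
  under [in X in _ = X -> _]eq_integral do rewrite E2 -/(X2 _).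
  have F (h bb a x c z : \bar R) : h * (bb * a) * x * (z * c) =
      h * bb * x * c * a * z.
    by rewrite !muleA (muleAC _ z c) (muleAC _ a x) (muleAC _ a c).
  have bA w : (\1_(b u) w)%:E * (\1_A w)%:E = (\1_(b u `&` A) w)%:E :> \bar R.
    by rewrite indicI EFinM.
  move=> e; under eq_integral do rewrite /W1 -F bA.
  by rewrite e; apply: eq_integral => w _; rewrite /W2 -F bA.
- by move=> w; rewrite prob_kernel.
- exact: mk.
Qed.

(** In the applications [p] is the passage to a history, [Y u] the mark or the lifetime of the label
    [u], and [b u] the event that [u] is born. The condition [kNb] makes up for the restriction of
    [indep] to born labels. *)
Lemma conditional_independence s (H : T' -> \bar R) :
  uniq s -> {in s, forall u, I u} ->
  (forall w, 0 <= H w <= 1) -> measurable_fun setT H ->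
  \int[P]_w (H (p w) * \prod_(u <- s) k u (p w, Y u w)) =
  \int[P]_w (H (p w) * \prod_(u <- s) \int[K u (p w)]_e k u (p w, e)).
Proof.
move=> us sI H01 mH.
have := @cond_indep_rec s [::] (fun=> setT) H.
rewrite cats0 => /(_ us sI (fun=> measurableT) H01 mH (fun _ _ _ => ltac:(by []))).
under eq_integral do rewrite big_nil mule1.
by under [RHS]eq_integral do rewrite big_nil mule1.
Qed.

End conditional_independence.

(** * Laplace functionals of Poisson processes *)

Section poisson_mass.
Context {R : realType}.
Implicit Types (m : \bar R) (c r : R).

(** At rate 0 [poisson_prob] is the Dirac mass at 0, with which the formula agrees because 0 ^+ 0 =
    1. *)
Lemma poisson_massE r n : (0 <= r)%R ->
  poisson_mass r%:E n = (r ^+ n * n`!%:R^-1 * expR (- r))%:E.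
Proof.
rewrite le_eqVlt => /predU1P[<-|r0]; rewrite /poisson_mass /poisson_prob.
  rewrite ltxx oppr0 expR0 mulr1 diracE; case: n => [|n].
    by rewrite mem_set// expr0 mul1r fact0 invr1.
  by rewrite memNset// expr0n/= mul0r.
rewrite r0 esum_set1 ?lee_fin ?poisson_pmf_ge0//.
by rewrite /poisson_pmf r0.
Qed.

Lemma poisson_mass_ge0 m n : 0 <= poisson_mass m n.
Proof. by case: m => // r; exact: measure_ge0. Qed.

Lemma poisson_mass_le1 m n : poisson_mass m n <= 1.
Proof.
case: m => //= r; exact: (probability_le1 (poisson_prob r 0%N)).
Qed.

Lemma measurable_poisson_mass n :
  measurable_fun [set x : \bar R | 0 <= x] (poisson_mass ^~ n).
Proof.
pose g (x : \bar R) : \bar R := if x == +oo then 0 else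
  (fine x ^+ n * n`!%:R^-1 * expR (- fine x))%:E.
apply: (eq_measurable_fun g).
  move=> [r| |]; rewrite inE /g ?eqxx// => r0.
  by rewrite poisson_massE// -lee_fin.
apply: measurable_funTS; apply: measurable_fun_ifT => //.
  exact: measurable_fun_eqe.
apply/measurable_EFinP; apply: measurable_funM.
  apply: measurable_funM => //.
  exact: measurable_funX.
by apply: measurableT_comp => //; apply: measurableT_comp.
Qed.

(** For finite m this is the exponential series at m exp (- c). For m = +oo all the point masses
    vanish, and c > 0 makes the right-hand side exp (-oo) = 0. *)
Lemma poisson_mass_laplace m c : 0 <= m -> (0 < c)%R ->
  \sum_(n <oo) (expR (- (c * n%:R)))%:E * poisson_mass m n =
  expeR (- ((1 - expR (- c))%:E * m)).
Proof.
move=> m0 c0; case: m m0 => [r| |]//; last first.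
  move=> _; rewrite gt0_muley ?lte_fin ?subr_gt0 ?expR_lt1 ?oppr_lt0//=.
  by rewrite eseries0// => i _ _; rewrite mule0.
rewrite lee_fin => r0.
rewrite (_ : - _ = (- r + r * expR (- c))%:E); last first.
  by rewrite -EFinM -EFinN; congr EFin; rewrite mulrBl mul1r opprB addrC mulrC.
rewrite [RHS](_ : _ = (expR (- r) * expR (r * expR (- c)))%:E); last first.
  by rewrite -expRD.
under eq_eseriesr.
  move=> n _; rewrite poisson_massE// -EFinM.
  rewrite (_ : (_ * (_ * _ * _))%R = (expR (- r) * (exp_coeff (r * expR (- c)) n))%R).
    rewrite EFinM; over.
  rewrite /exp_coeff/= exprMn -expRM_natr mulNr.
  by ring.
rewrite nneseriesZl/=; last first.
  move=> n _; rewrite lee_fin/exp_coeff/= divr_ge0// exprn_ge0//.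
  by rewrite mulr_ge0 ?expR_ge0.
rewrite EFinM; congr (_ * _); set y := (r * expR (- c))%R.
rewrite expRE -EFin_lim; last first.
  rewrite /pseries; under eq_fun do rewrite mulrC.
  exact: is_cvg_series_exp_coeff.
apply/congr_lim/funext => n/=; rewrite /pseries /series/= -sumEFin//.
by apply: eq_bigr => i _; congr EFin; exact: mulrC.
Qed.

End poisson_mass.

Section poisson_family.
Context d (T : measurableType d) (R : realType) (P : probability T R).
Variables (J : eqType) (s0 : seq J) (N m : J -> T -> \bar R) (A : set T).
Hypotheses (mN : forall j, measurable_fun setT (N j))
  (N_int : forall j w, N j w = +oo \/ exists n : nat, N j w = n%:R%:E)
  (mm : forall j, measurable_fun setT (m j))
  (m0 : forall j w, 0 <= m j w) (mA : measurable A).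
Hypothesis pois : forall (s : seq J) (k : J -> nat),
  uniq s -> {subset s <= s0} ->
  P (A `&` [set w | {in s, forall j, N j w = (k j)%:R%:E}]) =
  \int[P]_(w in A) \prod_(j <- s) poisson_mass (m j w) (k j).
Variables (c : J -> R).
Hypothesis c0 : {in s0, forall j, (0 < c j)%R}.

Let mass_meas j n : measurable_fun setT (fun w => poisson_mass (m j w) n).
Proof.
have h := @measurable_poisson_mass R n.
apply: (measurable_comp (F := [set x | 0 <= x]) _ _ h) => //; last first.
  by move=> _ [w _ <-]; exact: m0.
rewrite (_ : [set x | 0 <= x] = setT `&` [set x : \bar R | cst 0 x <= x]).
  exact: (measurable_lee measurableT).
by rewrite setTI.
Qed.

Let mexpR (U : T -> \bar R) (a : R) : measurable_fun setT U ->
  measurable_fun setT (fun w => expeR (- (a%:E * U w))).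
Proof.
move=> mU; apply: measurableT_comp; first exact: measurable_expeR.
by apply: measurableT_comp => //; exact: measurable_funeM.
Qed.

(* Expanding exp (- c N) = sum_n exp (- c n) 1_(N = n) moves an index from s1 to
   s2; the event N = +oo does not contribute because 0 < c. *)
Let poisson_family_rec s1 s2 (k : J -> nat) :
  uniq (s1 ++ s2) -> {subset s1 ++ s2 <= s0} ->
  \int[P]_(w in A) (\prod_(j <- s1) expeR (- ((c j)%:E * N j w)) *
    \prod_(j <- s2) (\1_[set w | N j w = (k j)%:R%:E] w)%:E) =
  \int[P]_(w in A)
    (\prod_(j <- s1) expeR (- ((1 - expR (- c j))%:E * m j w)) *
     \prod_(j <- s2) poisson_mass (m j w) (k j)).
Proof.
have mNk j n : measurable [set w | N j w = n%:R%:E].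
  rewrite -[X in measurable X]setTI.
  exact: (measurable_eqe measurableT (mN j) (measurable_cst _)).
elim: s1 s2 k => [|j s1 ih] s2 k; rewrite ?cat0s => us ss0.
  under eq_integral do rewrite big_nil mul1e.
  under [RHS]eq_integral do rewrite big_nil mul1e.
  rewrite -pois//; under eq_integral do rewrite prod_indic.
  rewrite integral_indic//; last exact: measurable_in_seq.
  by rewrite setIC.
have /andP[jNs us12] : (j \notin s1 ++ s2) && uniq (s1 ++ s2) by [].
have cj0 : (0 < c j)%R by apply/c0/ss0; rewrite mem_head.
have ss2 : {subset s1 ++ j :: s2 <= s0}.
  by move=> i; rewrite mem_cat !inE orbCA -mem_cat => ?; apply: ss0; rewrite inE.
have us2 : uniq (s1 ++ j :: s2) by rewrite -cat1s uniq_catCA.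
have NE w : expeR (- ((c j)%:E * N j w)) = \sum_(n <oo)
    ((expR (- (c j * n%:R)))%:E * (\1_[set w | N j w = n%:R%:E] w)%:E).
  have [Ny|[n Nn]] := N_int j w.
    rewrite Ny gt0_muley ?lte_fin//= eseries0// => i _ _.
    by rewrite indicE memNset ?mule0//= Ny.
  rewrite (@nneseriesD1 _ _ n)//.
  rewrite indicE mem_set//= mule1 eseries0 ?adde0 ?Nn// => i _ /= ni.
  rewrite indicE memNset ?mule0//= Nn => -[/eqP].
  by rewrite eqr_nat eq_sym (negbTE ni).
have mE w : expeR (- ((1 - expR (- c j))%:E * m j w)) = \sum_(n <oo)
    ((expR (- (c j * n%:R)))%:E * poisson_mass (m j w) n).
  by rewrite poisson_mass_laplace.
pose X1 w := \prod_(j <- s1) expeR (- ((c j)%:E * N j w)).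
pose Y1 w := \prod_(j <- s2) (\1_[set w | N j w = (k j)%:R%:E] w)%:E : \bar R.
pose X2 w := \prod_(j <- s1) expeR (- ((1 - expR (- c j))%:E * m j w)).
pose Y2 w := \prod_(j <- s2) poisson_mass (m j w) (k j).
(* Termwise integration of the series, stated once for the indicators of the counts and for the
   Poisson masses. *)
have expand (Z X Y : T -> \bar R) (z : nat -> T -> \bar R) :
    (forall w, Z w = \sum_(n <oo) ((expR (- (c j * n%:R)))%:E * z n w)) ->
    (forall n w, 0 <= z n w) -> (forall w, 0 <= X w) -> (forall w, 0 <= Y w) ->
    (forall w, X w \is a fin_num) -> (forall w, Y w \is a fin_num) ->
    (forall n, measurable_fun setT (z n)) ->
    measurable_fun setT X -> measurable_fun setT Y ->
    \int[P]_(w in A) ((Z w * X w) * Y w) =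
    \sum_(n <oo) ((expR (- (c j * n%:R)))%:E *
      \int[P]_(w in A) (X w * (z n w * Y w))).
  move=> ZE z0 X0 Y0 Xf Yf mz mX mY.
  transitivity (\int[P]_(w in A) \sum_(n <oo) ((expR (- (c j * n%:R)))%:E *
      (X w * (z n w * Y w)))).
    apply: eq_integral => w _; rewrite ZE -muleA muleC.
    have XYf : X w * Y w \is a fin_num by rewrite fin_numM.
    rewrite -(fineK XYf) -nneseriesZl; last first.
      by move=> n _; rewrite mule_ge0 ?lee_fin ?expR_ge0.
    apply: eq_eseriesr => n _; rewrite fineK//.
    by rewrite muleCA; congr (_ * _); rewrite -muleA; congr (_ * _); rewrite muleC.
  rewrite integral_nneseries//; last 2 first.
  - move=> n; apply: measurable_funTS; apply: measurable_funeM.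
    by apply: emeasurable_funM => //; exact: emeasurable_funM.
  - by move=> n w _; rewrite !mule_ge0 ?lee_fin ?expR_ge0.
  apply: eq_eseriesr => n _; rewrite ge0_integralZl//.
  - apply: measurable_funTS.
    by apply: emeasurable_funM => //; exact: emeasurable_funM.
  - by move=> w _; rewrite !mule_ge0.
have fin01 (x : \bar R) : 0 <= x <= 1 -> x \is a fin_num.
  by move=> /andP[x0 x1]; rewrite ge0_fin_numE// (le_lt_trans x1)// ltry.
have ge01 (x : \bar R) : 0 <= x <= 1 -> 0 <= x by case/andP.
have exp01 a (x : \bar R) : (0 <= a)%R -> 0 <= x ->
    0 <= expeR (- (a%:E * x)) <= 1.
  by move=> a0 x0; rewrite expeR_ge0 expeRN_le1// mule_ge0.
have N0 i w : 0 <= N i w by case: (N_int i w) => [->//|[n ->]]; rewrite lee_fin.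
have s1c : {in s1, forall i, (0 < c i)%R}.
  by move=> i is1; apply/c0/ss0; rewrite inE mem_cat is1 orbT.
have X101 w : 0 <= X1 w <= 1.
  by apply: prode_itv01 => i is1; apply: exp01 => //; exact/ltW/s1c.
have X201 w : 0 <= X2 w <= 1.
  apply: prode_itv01 => i is1; apply: exp01 => //.
  by rewrite subr_ge0 expR_le1 oppr_le0 ltW// s1c.
have Y101 w : 0 <= Y1 w <= 1.
  apply: prode_itv01 => i _.
  by rewrite !lee_fin indicE; case: (_ \in _); rewrite ?lexx ?ler01.
have Y201 w : 0 <= Y2 w <= 1.
  by apply: prode_itv01 => i _; rewrite poisson_mass_ge0 poisson_mass_le1.
have mX1 : measurable_fun setT X1 by apply: emeasurable_prod => i _; exact: mexpR.
have mX2 : measurable_fun setT X2 by apply: emeasurable_prod => i _; exact: mexpR.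
have mY1 : measurable_fun setT Y1.
  by apply: emeasurable_prod => i _; apply/measurable_EFinP/measurable_indic.
have mY2 : measurable_fun setT Y2 by apply: emeasurable_prod => i _.
under eq_integral do rewrite big_cons -/(X1 _) -/(Y1 _).
under [RHS]eq_integral do rewrite big_cons -/(X2 _) -/(Y2 _).
rewrite (expand _ X1 Y1 _ NE)//; last 5 first.
- by move=> w; exact: ge01.
- by move=> w; exact: ge01.
- by move=> w; exact: fin01.
- by move=> w; exact: fin01.
- by move=> n; exact/measurable_EFinP/measurable_indic.
rewrite (expand _ X2 Y2 _ mE)//; last 5 first.
- by move=> n w; exact: poisson_mass_ge0.
- by move=> w; exact: ge01.
- by move=> w; exact: ge01.
- by move=> w; exact: fin01.
- by move=> w; exact: fin01.
apply: eq_eseriesr => n _; congr (_ * _).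
pose k' i := if i == j then n else k i.
have k'E : {in s2, forall i, k' i = k i}.
  move=> i is2; rewrite /k'; case: eqP => // ij; move: jNs.
  by rewrite mem_cat -ij is2 orbT.
have := ih (j :: s2) k' us2 ss2.
have E1 w : \prod_(i <- j :: s2) (\1_[set w | N i w = (k' i)%:R%:E] w)%:E =
    (\1_[set w | N j w = n%:R%:E] w)%:E * Y1 w :> \bar R.
  rewrite big_cons {1}/k' eqxx; congr (_ * _).
  by apply: eq_big_seq => i is2; rewrite k'E.
have E2 w : \prod_(i <- j :: s2) poisson_mass (m i w) (k' i) =
    poisson_mass (m j w) n * Y2 w.
  rewrite big_cons {1}/k' eqxx; congr (_ * _).
  by apply: eq_big_seq => i is2; rewrite k'E.
under eq_integral do rewrite E1.
by under [in X in _ = X -> _]eq_integral do rewrite E2.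
Qed.

(** The coefficient depends on the index because an index will be a pair of a label and a value of a
    simple function, and that value will be the coefficient. *)
Lemma poisson_family_laplace s : uniq s -> {subset s <= s0} ->
  \int[P]_(w in A) \prod_(j <- s) expeR (- ((c j)%:E * N j w)) =
  \int[P]_(w in A)
    \prod_(j <- s) expeR (- ((1 - expR (- c j))%:E * m j w)).
Proof.
move=> us ss0; have := @poisson_family_rec s [::] (fun=> 0%N).
rewrite cats0 => /(_ us ss0).
under eq_integral do rewrite big_nil mule1.
by under [RHS]eq_integral do rewrite big_nil mule1.
Qed.

End poisson_family.

Lemma cvg_integral01 d (T : measurableType d) (R : realType)
    (P : probability T R) (D : set T) (g : (T -> \bar R)^nat) (f : T -> \bar R) :
  measurable D -> (forall n, measurable_fun D (g n)) ->
  (forall n w, 0 <= g n w <= 1) -> (forall w, g n w @[n --> \oo] --> f w) ->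
  \int[P]_(w in D) g n w @[n --> \oo] --> \int[P]_(w in D) f w.
Proof.
move=> mD mg g01 gf.
have mf : measurable_fun D f.
  by apply: (emeasurable_fun_cvg _ f mg) => w _; exact: gf.
have i1 : P.-integrable D (cst 1).
  apply: (integrableS measurableT) => //.
  by apply: finite_measure_integrable_cst.
have [] := @dominated_convergence _ _ _ P D mD g f (cst 1) mg mf _ i1.
- by apply: aeW => w _; exact: gf.
- apply: aeW => w n _; have /andP[g0 g1] := g01 n w.
  by rewrite gee0_abs.
- by [].
Qed.

Section nnsfun_values.
Context d (E : measurableType d) (R : realType).
Import HBNNSimple.
Variable F : {nnsfun E >-> R}.

(** The value 0 is left out: it contributes nothing to the integrals below, whatever the measure of
    its level set, and the coefficients in [poisson_mass_laplace] have to be positive. *)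
Definition nnsfun_values : seq R := [seq c <- enum_fset (fset_set (range F)) | c != 0%R].

Lemma nnsfun_values_uniq : uniq nnsfun_values.
Proof. exact/filter_uniq/fset_uniq. Qed.

Lemma nnsfun_values_gt0 : {in nnsfun_values, forall c, (0 < c)%R}.
Proof.
move=> c; rewrite mem_filter => /andP[c0].
by rewrite in_fset_set// inE => -[z _ zc]; rewrite lt0r c0 -zc/=.
Qed.

Lemma integral_comp_nnsfun (mu : {measure set E -> \bar R}) (phi : R -> R)
    (r : E -> \bar R) : (forall c, (0 <= c)%R -> (0 <= phi c)%R) ->
    phi 0%R = 0%R -> (forall z, 0 <= r z) -> measurable_fun setT r ->
  \int[mu]_z ((phi (F z))%:E * r z) =
  \sum_(c <- nnsfun_values)
    (phi c)%:E * \int[mu]_(z in F @^-1` [set c]) r z.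
Proof.
move=> phi0 phi00 r0 mr.
(* The guard on the sign of c makes each summand nonnegative for every real c, as the exchange of
   sum and integral requires, while [phi] is controlled on nonnegative numbers only. *)
transitivity (\int[mu]_z (\sum_(c <- nnsfun_values)
    (if (0 <= c)%R then (phi c)%:E else 0) * (r \_ (F @^-1` [set c])) z)).
  apply: eq_integral => z _; have [Fz0|Fz0] := eqVneq (F z) 0%R.
    rewrite Fz0 phi00 mul0e big_seq big1// => c cF.
    rewrite patchE memNset ?mule0//= Fz0 => c0.
    by have := nnsfun_values_gt0 cF; rewrite -c0 ltxx.
  rewrite (bigD1_seq (F z))/= ?nnsfun_values_uniq//; last first.
    by rewrite mem_filter Fz0 in_fset_set// inE; exists z.
  rewrite fun_ge0 patchE mem_set// big1 ?adde0// => c cF.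
  rewrite patchE memNset ?mule0//= => /eqP; rewrite eq_sym.
  by rewrite (negbTE cF).
rewrite ge0_integral_sum//; last 2 first.
- move=> c; apply: measurable_funeM; apply/(measurable_restrictT _ _).1 => //.
  exact: measurable_funTS.
- move=> c z _; rewrite mule_ge0//; first by case: ifPn => // ?; rewrite lee_fin phi0.
  by rewrite patchE; case: ifP.
apply: eq_big_seq => c cF; have c0 := nnsfun_values_gt0 cF.
rewrite (ltW c0) ge0_integralZl//.
- by rewrite -integral_mkcond.
- by apply/(measurable_restrictT _ _).1 => //; exact: measurable_funTS.
- by move=> z _; rewrite patchE; case: ifP.
- by rewrite lee_fin phi0// ltW.
Qed.

End nnsfun_values.

Section poisson_laplace.
Context d dE (T : measurableType d) (E : measurableType dE) (R : realType)
  (P : probability T R) (mu : {measure set E -> \bar R}).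
Variables (L : eqType) (I : set L) (N : L -> T -> {measure set E -> \bar R})
  (rho : L -> T * E -> \bar R) (A : set T).
Hypotheses (mN : forall u C, measurable C -> measurable_fun setT (N u ^~ C))
  (N_int : forall u C w, measurable C ->
    N u w C = +oo \/ exists n : nat, N u w C = n%:R%:E)
  (mrho : forall u, measurable_fun setT (rho u))
  (rho0 : forall u z, 0 <= rho u z)
  (rho_fin : forall u z, rho u z \is a fin_num) (mA : measurable A).
Hypothesis mint : forall k : T * E -> \bar R, (forall z, 0 <= k z) ->
  measurable_fun setT k -> measurable_fun setT (fun w => \int[mu]_z k (w, z)).
Hypothesis pois : forall (n : nat) (i : 'I_n -> L) (C : 'I_n -> set E)
    (k : 'I_n -> nat),
  (forall a, I (i a)) -> (forall a, measurable (C a)) ->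
  (forall a b, a != b -> i a = i b -> C a `&` C b = set0) ->
  P (A `&` [set w | forall a, N (i a) w (C a) = (k a)%:R%:E]) =
  \int[P]_(w in A)
    \prod_(a < n) poisson_mass (\int[mu]_(z in C a) rho (i a) (w, z)) (k a).

Import HBNNSimple.

Let mrho1 u w : measurable_fun setT (fun z => rho u (w, z)).
Proof. by apply: measurableT_comp => //; exact: pair1_measurable. Qed.

Let measurable_int_rho (h : E -> \bar R) u :
  measurable_fun setT h -> (forall z, 0 <= h z) ->
  measurable_fun setT (fun w => \int[mu]_z (h z * rho u (w, z))).
Proof.
move=> mh h0; apply: (mint (k := fun x : T * E => h x.2 * rho u x)).
  by move=> x; rewrite mule_ge0.
by apply: emeasurable_funM => //; exact: measurableT_comp.
Qed.

(** The integral of a simple function is a finite combination of the counts of its level sets, so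
    the claim is [poisson_family_laplace] for the family of counts indexed by pairs of a label and a
    nonzero value. *)
Let poisson_laplace_simple (F : {nnsfun E >-> R}) (s : seq L) :
  uniq s -> {in s, forall u, I u} ->
  \int[P]_(w in A) expeR (- \sum_(u <- s) \int[N u w]_z (F z)%:E) =
  \int[P]_(w in A) expeR (- \sum_(u <- s)
     \int[mu]_z ((1 - expR (- F z))%:E * rho u (w, z))).
Proof.
move=> us sI.
pose J : eqType := (L * R)%type.
pose s0 : seq J := [seq (u, c) | u <- s, c <- nnsfun_values F].
pose Nj (j : J) w := N j.1 w (F @^-1` [set j.2]).
pose mj (j : J) w := \int[mu]_(z in F @^-1` [set j.2]) rho j.1 (w, z).
have s0P j : j \in s0 -> I j.1 /\ (0 < j.2)%R.
  by move=> /allpairsP[[u c]/= [us' cF ->]]; split;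
    [exact: sI|exact: (nnsfun_values_gt0 cF)].
have mF c : measurable (F @^-1` [set c]) by [].
have F1 u w : \int[N u w]_z (F z)%:E =
    \sum_(c <- nnsfun_values F) (c%:E * Nj (u, c) w).
  transitivity (\int[N u w]_z ((F z)%:E * cst 1 z)).
    by apply: eq_integral => z _; rewrite mule1.
  rewrite (integral_comp_nnsfun F (N u w) (phi := id))//.
  by apply: eq_bigr => c _; rewrite integral_cst// mul1e.
have F2 u w : \int[mu]_z ((1 - expR (- F z))%:E * rho u (w, z)) =
    \sum_(c <- nnsfun_values F) ((1 - expR (- c))%:E * mj (u, c) w).
  rewrite (integral_comp_nnsfun F mu (phi := fun x => 1 - expR (- x))%R)//.
    by move=> c c0; rewrite subr_ge0 expR_le1 oppr_le0.
  by rewrite oppr0 expR0 subrr.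
have Nj0 j w : 0 <= Nj j w by [].
have mj0 j w : 0 <= mj j w by exact: integral_ge0.
have us0 : uniq s0.
  apply: allpairs_uniq => //; first exact: nnsfun_values_uniq.
  by move=> [? ?] [? ?] _ _ [-> ->].
transitivity (\int[P]_(w in A) \prod_(j <- s0) expeR (- (j.2%:E * Nj j w))).
  apply: eq_integral => w _.
  rewrite -expeRN_sum.
    by rewrite big_allpairs; congr (expeR (- _)); apply: eq_bigr => u _.
  by move=> j /s0P[_ j0]; rewrite mule_ge0// lee_fin ltW.
transitivity (\int[P]_(w in A)
    \prod_(j <- s0) expeR (- ((1 - expR (- j.2))%:E * mj j w))); last first.
  apply: eq_integral => w _.
  rewrite -expeRN_sum.
    by rewrite big_allpairs; congr (expeR (- _)); apply: eq_bigr => u _.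
  move=> j /s0P[_ j0]; rewrite mule_ge0// lee_fin subr_ge0 expR_le1 oppr_le0.
  exact: ltW.
apply: (@poisson_family_laplace _ _ _ P J s0 Nj mj A) => //.
- by move=> j; exact: mN.
- by move=> j w; exact: N_int.
- move=> j; rewrite (_ : mj j = fun w =>
    \int[mu]_z ((\1_(F @^-1` [set j.2]) z)%:E * rho j.1 (w, z))).
    apply: measurable_int_rho => [|z]; last by rewrite lee_fin.
    exact/measurable_EFinP/measurable_indic.
  apply/funext => w; rewrite /mj integral_mkcond; apply: eq_integral => z _.
  by rewrite patchE indicE; case: ifP => _; rewrite ?mul1e ?mul0e.
- move=> s' k us' ss'.
  have := @pois (size s') (fun a => (tnth (in_tuple s') a).1)
    (fun a => F @^-1` [set (tnth (in_tuple s') a).2])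
    (fun a => k (tnth (in_tuple s') a)).
  have h1 a : I (tnth (in_tuple s') a).1.
    by have [] := s0P _ (ss' _ (mem_tnth a (in_tuple s'))).
  (* Two distinct indices with the same label carry distinct values, hence disjoint level sets; this
     is the disjointness that [pois] asks for. *)
  have h2 (a b : 'I_(size s')) : a != b ->
      (tnth (in_tuple s') a).1 = (tnth (in_tuple s') b).1 ->
      F @^-1` [set (tnth (in_tuple s') a).2] `&`
      F @^-1` [set (tnth (in_tuple s') b).2] = set0.
    move=> ab e1; apply/seteqP; split=> // z [/= -> e2].
    have := ab; rewrite -(inj_eq val_inj)/= => /eqP; apply.
    have ua : uniq (in_tuple s') by [].
    apply/eqP; rewrite -(nth_uniq (tnth (in_tuple s') a) _ _ us')//.
    rewrite -!(tnth_nth _ (in_tuple s')); apply/eqP.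
    by move: e1 e2; case: (tnth _ a) => ? ?; case: (tnth _ b) => ? ? /= -> ->.
  move=> /(_ h1 (fun=> mF _) h2) h.
  transitivity (P (A `&` [set w | forall a : 'I_(size s'),
      Nj (tnth (in_tuple s') a) w = (k (tnth (in_tuple s') a))%:R%:E])).
    congr (P (_ `&` _)); apply/seteqP; split=> w /=.
      by move=> sw a; apply: sw; exact: mem_tnth.
    by move=> sw j /(tnthP (in_tuple s'))[a ->].
  rewrite h; apply: eq_integral => w _.
  by rewrite [RHS](big_tnth _ _ s').
- by move=> j /s0P[].
Qed.

(** Along simple functions increasing to [F] both exponents increase, and the exponentials stay in
    [0, 1]. The value +oo must be allowed for [F]: it will be minus the logarithm of a factor that
    may vanish. *)
Lemma poisson_laplace (F : E -> \bar R) (s : seq L) :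
  (forall z, 0 <= F z) -> measurable_fun setT F ->
  uniq s -> {in s, forall u, I u} ->
  \int[P]_(w in A) expeR (- \sum_(u <- s) \int[N u w]_z F z) =
  \int[P]_(w in A) expeR (- \sum_(u <- s)
     \int[mu]_z ((1 - expeR (- F z)) * rho u (w, z))).
Proof.
move=> F0 mF us sI; pose h := nnsfun_approx measurableT mF.
have mh n : measurable_fun setT (fun z => (h n z)%:E) by exact/measurable_EFinP.
have ndh m n z : (m <= n)%N -> (h m z <= h n z)%R.
  by move=> mn; exact/lefP/nd_nnsfun_approx.
have hF z : (h n z)%:E @[n --> \oo] --> F z by exact: cvg_nnsfun_approx.
have ndsum (x : nat -> L -> \bar R) : (forall u, nondecreasing_seq (x ^~ u)) ->
    nondecreasing_seq (fun n => \sum_(u <- s) x n u).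
  by move=> ndx m n mn; apply: lee_sum => u _; exact: ndx.
have limsum (x : nat -> L -> \bar R) y : (forall u, nondecreasing_seq (x ^~ u)) ->
    (forall n u, 0 <= x n u) -> (forall u, x n u @[n --> \oo] --> y u) ->
    expeR (- \sum_(u <- s) x n u) @[n --> \oo] --> expeR (- \sum_(u <- s) y u).
  move=> ndx x0 xy; apply: cvg_expeRN; first exact: ndsum.
  elim: (s) => [|u s' ih].
    by under eq_fun do rewrite big_nil; rewrite big_nil; exact: cvg_cst.
  under eq_fun do rewrite big_cons; rewrite big_cons.
  apply: cvgeD => //.
  rewrite ge0_adde_def// inE.
    by apply: (cvge_ge _ (xy u)) => //; apply: nearW => n; exact: x0.
  by apply: (cvge_ge _ ih) => //; apply: nearW => n; exact: sume_ge0.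
have ndN u w : nondecreasing_seq (fun n => \int[N u w]_z (h n z)%:E).
  move=> m n mn; apply: ge0_le_integral => //.
  - by move=> z _; rewrite lee_fin.
  - by move=> z _; rewrite lee_fin ndh.
have cN u w : \int[N u w]_z (h n z)%:E @[n --> \oo] --> \int[N u w]_z F z.
  rewrite [X in _ --> X](_ : _ = \int[N u w]_z limn (fun n => (h n z)%:E)).
    apply: cvg_monotone_convergence => //.
    - by move=> n z _; rewrite lee_fin.
    - by move=> z _ m n mn; rewrite lee_fin ndh.
  by apply: eq_integral => z _; apply/esym/cvg_lim.
pose q n z : \bar R := (1 - expR (- h n z))%:E.
have q0 n z : 0 <= q n z by rewrite lee_fin subr_ge0 expR_le1 oppr_le0.
have mq n : measurable_fun setT (q n).
  apply/measurable_EFinP/measurable_funB => //.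
  by apply: measurableT_comp => //; exact: measurableT_comp.
have ndq m n z : (m <= n)%N -> q m z <= q n z.
  by move=> mn; rewrite lee_fin lerB// ler_expR lerN2 ndh.
have cq z : q n z @[n --> \oo] --> 1 - expeR (- F z).
  have : expeR (- (h n z)%:E) @[n --> \oo] --> expeR (- F z).
    by apply: cvg_expeRN => // m n mn; rewrite lee_fin ndh.
  move=> c; rewrite (_ : q^~ z = fun n => 1 - expeR (- (h n z)%:E)).
    by apply: cvgeB => //; exact: cvg_cst.
  by apply/funext.
have mqr n u w : measurable_fun setT (fun z => q n z * rho u (w, z)).
  exact: emeasurable_funM.
have nd2 u w : nondecreasing_seq (fun n => \int[mu]_z (q n z * rho u (w, z))).
  move=> m n mn; apply: ge0_le_integral => //.
  - by move=> z _; rewrite mule_ge0.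
  - by move=> z _; rewrite lee_wpmul2r// ndq.
have c2 u w : \int[mu]_z (q n z * rho u (w, z)) @[n --> \oo] -->
    \int[mu]_z ((1 - expeR (- F z)) * rho u (w, z)).
  rewrite [X in _ --> X](_ : _ =
      \int[mu]_z limn (fun n => q n z * rho u (w, z))).
    apply: cvg_monotone_convergence => //.
    - by move=> n z _; rewrite mule_ge0.
    - by move=> z _ m n mn; rewrite lee_wpmul2r// ndq.
  apply: eq_integral => z _; apply/esym/cvg_lim => //.
  by apply: cvgeZr => //; exact: cq.
pose U n w := expeR (- \sum_(u <- s) \int[N u w]_z (h n z)%:E).
pose V n w := expeR (- \sum_(u <- s) \int[mu]_z (q n z * rho u (w, z))).
have UV n : \int[P]_(w in A) U n w = \int[P]_(w in A) V n w.
  exact: poisson_laplace_simple.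
have cU : \int[P]_(w in A) U n w @[n --> \oo] -->
    \int[P]_(w in A) expeR (- \sum_(u <- s) \int[N u w]_z F z).
  apply: cvg_integral01 => //.
  - move=> n; apply: measurable_funTS; apply: measurableT_comp.
      exact: measurable_expeR.
    apply: measurableT_comp => //; apply: emeasurable_sum => u.
    apply: measurable_fun_integral_kernel => //; first exact: mN.
    by move=> z; rewrite lee_fin.
  - move=> n w; rewrite expeR_ge0 expeRN_le1// sume_ge0// => u _.
    by apply: integral_ge0 => z _; rewrite lee_fin.
  - move=> w; apply: limsum => //.
    by move=> n u; apply: integral_ge0 => z _; rewrite lee_fin.
have cV : \int[P]_(w in A) V n w @[n --> \oo] --> \int[P]_(w in A)
    expeR (- \sum_(u <- s) \int[mu]_z ((1 - expeR (- F z)) * rho u (w, z))).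
  apply: cvg_integral01 => //.
  - move=> n; apply: measurable_funTS; apply: measurableT_comp.
      exact: measurable_expeR.
    apply: measurableT_comp => //; apply: emeasurable_sum => u.
    exact: measurable_int_rho.
  - move=> n w; rewrite expeR_ge0 expeRN_le1// sume_ge0// => u _.
    by apply: integral_ge0 => z _; rewrite mule_ge0.
  - move=> w; apply: limsum => //.
    by move=> n u; apply: integral_ge0 => z _; rewrite mule_ge0.
rewrite (funext UV) in cU; exact: (cvg_unique _ cU cV).
Qed.

End poisson_laplace.

(** * Sums over countable sets of labels *)

Section countable_enumeration.
Context (L : countType) (R : realType).
Implicit Types (U : set L) (a : L -> \bar R).

(** An increasing exhaustion of [U] by duplicate-free finite sequences, along pickling codes. It
    turns a sum over [U] into the limit of a sequence, to which the convergence theorems apply. *)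
Definition first_elements U (n : nat) : seq L :=
  [seq u <- pmap (@pickle_inv L) (iota 0 n) | u \in U].

Lemma first_elements_uniq U n : uniq (first_elements U n).
Proof. by rewrite filter_uniq// (pmap_uniq (@pickle_invK L)) ?iota_uniq. Qed.

Lemma mem_first_elements U n u :
  (u \in first_elements U n) = (u \in U) && (pickle u < n)%N.
Proof.
rewrite mem_filter; congr (_ && _); rewrite mem_pmap; apply/mapP/idP.
  move=> [i]; rewrite mem_iota/= add0n => iltn /esym ui.
  by have := @pickle_invK L i; move: ui; case: (pickle_inv i) => //= v [->] ->.
by move=> un; exists (pickle u); rewrite ?mem_iota// pickleK_inv.
Qed.

Lemma first_elements_sub U n : {in first_elements U n, forall u, U u}.
Proof. by move=> u; rewrite mem_first_elements => /andP[/set_mem]. Qed.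

Lemma nondecreasing_first_elements U a : (forall u, U u -> 0 <= a u) ->
  nondecreasing_seq (fun n => \sum_(u <- first_elements U n) a u).
Proof.
move=> a0 m n mn; rewrite (@fsbig_seq _ _ _ _ (first_elements U m)) ?first_elements_uniq//.
rewrite (@fsbig_seq _ _ _ _ (first_elements U n)) ?first_elements_uniq//.
apply: lee_fsum_nneg_subset => //.
  move=> u; rewrite !inE/= !mem_first_elements => /andP[-> um] /=.
  exact: leq_trans um mn.
by move=> u; rewrite inE => /andP[_]; rewrite inE => /first_elements_sub; exact: a0.
Qed.

Lemma cvg_first_elements U a : (forall u, U u -> 0 <= a u) ->
  \sum_(u <- first_elements U n) a u @[n --> \oo] --> \esum_(u in U) a u.
Proof.
move=> a0.
suff -> : \esum_(u in U) a u =
    ereal_sup (range (fun n => \sum_(u <- first_elements U n) a u)).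
  exact/ereal_nondecreasing_cvgn/nondecreasing_first_elements.
apply/eqP; rewrite eq_le; apply/andP; split.
  apply: ge_ereal_sup => _ [A [/finite_seqP[s As] AU] <-].
  pose n := (\max_(u <- s) pickle u).+1.
  apply: (@le_trans _ _ (\sum_(u <- first_elements U n) a u)); last first.
    by apply: ereal_sup_ubound; exists n.
  rewrite (@fsbig_seq _ _ _ _ (first_elements U n)) ?first_elements_uniq//.
  apply: lee_fsum_nneg_subset => //.
  - by apply/finite_seqP; exists s.
  - move=> u; rewrite !inE/= mem_first_elements => Au.
    rewrite mem_set; last exact: AU.
    by rewrite /= ltnS leq_bigmax_seq//; move: Au; rewrite As.
  - by move=> u; rewrite inE => /andP[_]; rewrite inE => /first_elements_sub; exact: a0.
apply: ge_ereal_sup => _ [n _ <-].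
apply: ereal_sup_ubound; exists [set` first_elements U n].
  split; last by move=> u; exact: first_elements_sub.
  by apply/finite_seqP; exists (first_elements U n).
by rewrite (@fsbig_seq _ _ _ _ (first_elements U n)) ?first_elements_uniq.
Qed.

Lemma measurable_esum d (T : measurableType d) U (c : L -> T -> \bar R) :
  (forall u w, U u -> 0 <= c u w) ->
  (forall u, U u -> measurable_fun setT (c u)) ->
  measurable_fun setT (fun w => \esum_(u in U) c u w).
Proof.
move=> c0 mc; apply: (emeasurable_fun_cvg
  (fun n w => \sum_(u <- first_elements U n) c u w)) => [n|w _]; last first.
  by apply: cvg_first_elements => u; exact: c0.
apply: emeasurable_sum_in => u un.
exact/mc/(first_elements_sub un).
Qed.

(** Bounded convergence along [first_elements]. This is the passage from the finite families of
    labels, about which independence speaks, to a whole generation or to all labels. *)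
Lemma esum_laplace_eq d (T : measurableType d) (P : probability T R) U
    (H1 H2 : T -> \bar R) (c1 c2 : L -> T -> \bar R) :
  measurable_fun setT H1 -> measurable_fun setT H2 ->
  (forall w, 0 <= H1 w <= 1) -> (forall w, 0 <= H2 w <= 1) ->
  (forall u w, U u -> 0 <= c1 u w) -> (forall u w, U u -> 0 <= c2 u w) ->
  (forall u, U u -> measurable_fun setT (c1 u)) ->
  (forall u, U u -> measurable_fun setT (c2 u)) ->
  (forall s, uniq s -> {in s, forall u, U u} ->
    \int[P]_w (H1 w * expeR (- \sum_(u <- s) c1 u w)) =
    \int[P]_w (H2 w * expeR (- \sum_(u <- s) c2 u w))) ->
  \int[P]_w (H1 w * expeR (- \esum_(u in U) c1 u w)) =
  \int[P]_w (H2 w * expeR (- \esum_(u in U) c2 u w)).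
Proof.
move=> mH1 mH2 H101 H201 c10 c20 mc1 mc2 fin.
have cH (H : T -> \bar R) (c : L -> T -> \bar R) : measurable_fun setT H ->
    (forall w, 0 <= H w <= 1) -> (forall u w, U u -> 0 <= c u w) ->
    (forall u, U u -> measurable_fun setT (c u)) ->
    \int[P]_w (H w * expeR (- \sum_(u <- first_elements U n) c u w))
      @[n --> \oo] --> \int[P]_w (H w * expeR (- \esum_(u in U) c u w)).
  move=> mH H01 c0 mc.
  have sum0 n w : 0 <= \sum_(u <- first_elements U n) c u w.
    by rewrite big_seq; apply: sume_ge0 => u /first_elements_sub; exact: c0.
  apply: cvg_integral01 => //.
  - move=> n; apply: emeasurable_funM => //.
    apply: measurableT_comp; first exact: measurable_expeR.
    apply: measurableT_comp => //; apply: emeasurable_sum_in => u un.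
    exact/mc/(first_elements_sub un).
  - move=> n w; have /andP[Hw0 Hw1] := H01 w.
    rewrite mule_ge0 ?expeR_ge0//= -[leRHS]mule1 lee_pmul ?expeR_ge0//.
    exact: expeRN_le1.
  - move=> w; have /andP[Hw0 Hw1] := H01 w.
    apply: cvgeZl; first by rewrite ge0_fin_numE// (le_lt_trans Hw1)// ltry.
    apply: cvg_expeRN; last by apply: cvg_first_elements => u; exact: c0.
    by apply: nondecreasing_first_elements => u; exact: c0.
have h1 := cH _ _ mH1 H101 c10 mc1; have h2 := cH _ _ mH2 H201 c20 mc2.
have e : (fun n => \int[P]_w (H1 w * expeR (- \sum_(u <- first_elements U n) c1 u w)))
   = (fun n => \int[P]_w (H2 w * expeR (- \sum_(u <- first_elements U n) c2 u w))).
  apply/funext => n; apply: fin; first exact: first_elements_uniq.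
  exact: first_elements_sub.
by rewrite e in h1; exact: (cvg_unique _ h1 h2).
Qed.

End countable_enumeration.

(** * The generation recursion *)

(** Tonelli is applied to one real coordinate at a time, the other one being first counted among the
    parameters. *)
Lemma measurable_fun_integral_leb2 (R : realType) d (X : measurableType d)
    (k : X * (R * R) -> \bar R) :
  (forall z, 0 <= k z) -> measurable_fun setT k ->
  measurable_fun setT (fun x => \int[leb R \x leb R]_z k (x, z)).
Proof.
move=> k0 mk; pose k1 (z : (X * R) * R) := k (z.1.1, (z.1.2, z.2)).
have mk1 : measurable_fun setT k1.
  apply: measurableT_comp => //; apply: measurable_fun_pair.
    exact: measurableT_comp.
  by apply: measurable_fun_pair => //; exact: measurableT_comp.
pose k2 (z : X * R) := \int[leb R]_y k1 (z, y).
have mk2 : measurable_fun setT k2.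
  by apply: (measurable_fun_fubini_tonelli_F (m2 := leb R) k1) => // z; exact: k0.
rewrite [X in measurable_fun _ X](_ : _ = fun x => \int[leb R]_s k2 (x, s)).
  apply: (measurable_fun_fubini_tonelli_F (m2 := leb R) k2) => // z.
  by apply: integral_ge0 => y _; exact: k0.
apply/funext => x.
apply: (fubini_tonelli1 (m1 := leb R) (m2 := leb R) (fun z => k (x, z))) => //.
by apply: measurableT_comp => //; exact: pair1_measurable.
Qed.

Section generation_operator.
Context {R : realType} {dM : measure_display} {M : measurableType dM}.
Variables (PB : probability M R) (rate : (M * R) * (R * R) -> R)
  (g : R * R -> \bar R).
Implicit Types G : R * R -> \bar R.

(* In (r, y), r is the time left before the observation at time t, so that an event
   at time s and location y is read at (t - s, y). *)
Definition offspring_exponent G (x : M * (R * R)) : \bar R :=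
  \int[leb R \x leb R]_z
    ((1 - G z) * (rate ((x.1, x.2.2), (x.2.1 - z.1, z.2)%R))%:E).

(** The factor [g z] belongs to the event itself. All the children of an event share its single
    mark, so the mean over the mark is taken outside the exponential. *)
Definition generation_step G (z : R * R) : \bar R :=
  g z * \int[PB]_m expeR (- offspring_exponent G (m, z)).

(** The index counts the generations of descendants that are kept: the starting value [g] stands for
    an event without its descendants. *)
Definition generation_iter n : R * R -> \bar R := iter n generation_step g.

Hypotheses (mrate : measurable_fun setT rate) (rate0 : forall z, (0 <= rate z)%R)
  (mg : measurable_fun setT g) (g01 : forall z, 0 <= g z <= 1).

Let integrand01 G z x : (forall z, 0 <= G z <= 1) ->
  0 <= (1 - G z) * (rate x)%:E.
Proof.
move=> G01; have /andP[G0 G1] := G01 z; apply: mule_ge0; last by rewrite lee_fin.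
by rewrite subre_ge0.
Qed.

Lemma offspring_exponent_ge0 G x : (forall z, 0 <= G z <= 1) ->
  0 <= offspring_exponent G x.
Proof. by move=> G01; apply: integral_ge0 => z _; exact: integrand01. Qed.

Lemma measurable_offspring_integrand G x : measurable_fun setT G ->
  measurable_fun setT
    (fun z => (1 - G z) * (rate ((x.1, x.2.2), (x.2.1 - z.1, z.2)%R))%:E).
Proof.
move=> mG; apply: emeasurable_funM; first exact: emeasurable_funB.
apply/measurable_EFinP; apply: measurableT_comp => //.
apply: measurable_fun_pair => //; apply: measurable_fun_pair => //.
exact: measurable_funB.
Qed.

Lemma measurable_offspring_exponent G : measurable_fun setT G ->
  (forall z, 0 <= G z <= 1) -> measurable_fun setT (offspring_exponent G).
Proof.
move=> mG G01.
pose k (y : (M * (R * R)) * (R * R)) := (1 - G y.2) *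
  (rate ((y.1.1, y.1.2.2), (y.1.2.1 - y.2.1, y.2.2)%R))%:E.
apply: (measurable_fun_integral_leb2 (k := k)).
  by move=> y; exact: integrand01.
  apply: emeasurable_funM.
    by apply: emeasurable_funB => //; exact: measurableT_comp.
  apply/measurable_EFinP; apply: measurableT_comp => //.
  apply: measurable_fun_pair; apply: measurable_fun_pair.
  - by apply: measurableT_comp.
  - by do 2 apply: measurableT_comp => //.
  - apply: measurable_funB.
      by apply: measurableT_comp => //; exact: measurableT_comp.
    exact: measurableT_comp.
  - exact: measurableT_comp.
Qed.

Lemma measurable_expeRN_offspring G z : measurable_fun setT G ->
  (forall z, 0 <= G z <= 1) ->
  measurable_fun setT (fun m => expeR (- offspring_exponent G (m, z))).
Proof.
move=> mG G01; apply: measurableT_comp; first exact: measurable_expeR.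
apply: measurableT_comp => //; apply: measurableT_comp.
  exact: measurable_offspring_exponent.
exact: pair2_measurable.
Qed.

Lemma generation_step_itv01 G : measurable_fun setT G ->
  (forall z, 0 <= G z <= 1) -> forall z, 0 <= generation_step G z <= g z.
Proof.
move=> mG G01 z; have /andP[g0 g1] := g01 z.
rewrite mule_ge0//=; last by apply: integral_ge0 => m _; exact: expeR_ge0.
rewrite -[leRHS]mule1 lee_wpmul2l//.
rewrite -(probability_setT PB) -[leRHS]mul1e -integral_cst//.
apply: ge0_le_integral => //.
- by move=> m _; exact: expeR_ge0.
- exact: measurable_expeRN_offspring.
- by move=> m _; apply: expeRN_le1; exact: offspring_exponent_ge0.
Qed.

Lemma measurable_generation_step G : measurable_fun setT G ->
  (forall z, 0 <= G z <= 1) -> measurable_fun setT (generation_step G).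
Proof.
move=> mG G01; apply: emeasurable_funM => //.
apply: (measurable_fun_fubini_tonelli_F (m2 := PB)
  (fun y : (R * R) * M => expeR (- offspring_exponent G (y.2, y.1)))).
  apply: measurableT_comp; first exact: measurable_expeR.
  apply: measurableT_comp => //; apply: measurableT_comp.
    exact: measurable_offspring_exponent.
  exact: measurable_swap.
by move=> y; exact: expeR_ge0.
Qed.

Lemma le_generation_step G1 G2 : measurable_fun setT G1 ->
  measurable_fun setT G2 ->
  (forall z, 0 <= G1 z <= 1) -> (forall z, 0 <= G2 z <= 1) ->
  (forall z, G1 z <= G2 z) ->
  forall z, generation_step G1 z <= generation_step G2 z.
Proof.
move=> mG1 mG2 G101 G201 G12 z; have /andP[g0 g1] := g01 z.
rewrite lee_wpmul2l//; apply: ge0_le_integral => //.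
- by move=> m _; exact: expeR_ge0.
- exact: measurable_expeRN_offspring.
- exact: measurable_expeRN_offspring.
- move=> m _; rewrite lee_expeR leeN2; apply: ge0_le_integral => //.
  + by move=> x _; exact: integrand01.
  + exact: (measurable_offspring_integrand (m, z)).
  + exact: (measurable_offspring_integrand (m, z)).
  + by move=> x _; rewrite lee_wpmul2r ?lee_fin// leeB.
Qed.

Lemma generation_iter_prop n :
  measurable_fun setT (generation_iter n) /\
  forall z, 0 <= generation_iter n z <= 1.
Proof.
elim: n => [|n [mG G01]]; first by [].
split; first exact: measurable_generation_step.
move=> z; have /andP[/= -> le_g] := generation_step_itv01 mG G01 z.
by have /andP[_] := g01 z; apply: le_trans.
Qed.

(** The first inequality holds because a step multiplies [g] by a number in [0, 1], which is why
    [generation_step_itv01] has the bound [g z] rather than 1; monotonicity of the step propagates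
    it. *)
Lemma nonincreasing_generation_iter z :
  nonincreasing_seq (generation_iter ^~ z).
Proof.
apply/nonincreasing_seqP => n; elim: n z => [|n ih] z.
  by have [mG G01] := generation_iter_prop 0;
    have /andP[] := generation_step_itv01 mG G01 z.
have [mG G01] := generation_iter_prop n.
have [mG' G'01] := generation_iter_prop n.+1.
exact: le_generation_step.
Qed.

Hypotheses (rate_lt0 : forall a v x, (v < 0)%R -> rate (a, (v, x)) = 0%R)
  (g_lt0 : forall r y, (r < 0)%R -> g (r, y) = 1).

(** An event after the observation time contributes the factor 1, and so do its descendants, which
    are later still. This is what confines the time integral of the theorem to [0, t]. *)
Lemma generation_iter_lt0 n r y : (r < 0)%R -> generation_iter n (r, y) = 1.
Proof.
elim: n r y => [|n ih] r y r0; first exact: g_lt0.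
rewrite /= /generation_step g_lt0// mul1e (eq_integral (cst 1)).
  by rewrite integral_cst// mul1e; exact: probability_setT.
move=> m _; rewrite /offspring_exponent integral0_eq ?oppe0 ?expeR0// => -[s x] _ /=.
(* Either the child is itself after the observation time, or it would be born before its parent:
   then r - s is negative and the rate vanishes. *)
have [s0|s0] := ltP s 0%R; first by rewrite ih// subee// mul0e.
by rewrite rate_lt0 ?mule0//; lra.
Qed.

End generation_operator.

(** * Reflection of time *)

Section reflection.
Context {R : realType}.

(** The image of Lebesgue measure under s |-> t - s gives ]a, b] the length of [t - b, t - a[, which
    is b - a; half-open intervals determine the measure. *)
Lemma ge0_integral_reflect (t : R) (k : R -> \bar R) :
  measurable_fun setT k -> (forall s, 0 <= k s) ->
  \int[leb R]_s k (t - s)%R = \int[leb R]_s k s.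
Proof.
move=> mk k0; pose phi (s : measurableTypeR R) : measurableTypeR R := (t - s)%R.
have mphi : measurable_fun setT phi by exact: measurable_funB.
rewrite -[LHS](@ge0_integral_pushforward _ _ _ _ _ phi mphi _ setT)//.
apply: eq_measure_integral => A mA _.
apply/esym; apply: lebesgue_measure_unique => // _ [[a b]] _ <-.
rewrite /= /pushforward (_ : phi @^-1` _ = [set` `[(t - b)%R, (t - a)%R[]).
  rewrite !lebesgue_measure_itv/= !lte_fin ltrD2l ltrN2.
  by case: ifP => // _; congr EFin; ring.
apply/seteqP; split=> s /=; rewrite /phi !in_itv/= => /andP[? ?];
  by apply/andP; split; lra.
Qed.

Lemma ge0_integral_reflect2 (t : R) (k : R * R -> \bar R) :
  measurable_fun setT k -> (forall z, 0 <= k z) ->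
  \int[leb R \x leb R]_z k ((t - z.1)%R, z.2) = \int[leb R \x leb R]_z k z.
Proof.
move=> mk k0.
transitivity (\int[leb R]_y \int[leb R]_s k ((t - s)%R, y)).
  apply: (fubini_tonelli2 (m1 := leb R) (m2 := leb R)
    (fun z => k ((t - z.1)%R, z.2))) => //.
  apply: measurableT_comp => //; apply: measurable_fun_pair => //.
  exact: measurable_funB.
transitivity (\int[leb R]_y \int[leb R]_s k (s, y)).
  apply: eq_integral => y _; apply: (ge0_integral_reflect t (k := fun s => k (s, y))) => //.
  by apply: measurableT_comp => //; exact: pair2_measurable.
by apply/esym; apply: (fubini_tonelli2 (m1 := leb R) (m2 := leb R) k).
Qed.

End reflection.

(** * Events labelled by words *)

Section history.
Context {R : realType} {dT dM : measure_display} {T : measurableType dT}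
  {M : measurableType dM}.
Implicit Types (E : events T M R) (U V : set (seq nat)).

Definition history_generators E U V : set (set T) :=
  (\bigcup_(u in U) (generated_by (born E u) `|` generated_by (time E u)
                     `|` generated_by (loc E u)))
  `|` \bigcup_(u in V) generated_by (mark E u).

(* The underlying space with the coarser sigma-algebra [history E U V]. *)
Definition history_space E U V := g_sigma_algebraType (history_generators E U V).

(** Seen as a map into the coarser space, the identity turns conditioning on a sigma-algebra into
    conditioning on the value of a map, the form used by [weighted_law_unique] and
    [conditional_independence]. *)
Definition to_history E U V : T -> history_space E U V := id.

Lemma measurable_to_history E U V : measurable_fun setT (to_history E U V).
Proof.
have gen d (Y : measurableType d) (X : {mfun T >-> Y}) :
    generated_by X `<=` measurable.
  by move=> _ [B mB <-]; exact: (measurable_funP X).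
move=> _ A mA; rewrite setTI; rewrite /to_history preimage_id.
apply: (@smallest_sub _ (sigma_algebra setT) (history_generators E U V)
  (@measurable _ T)) (mA).
  exact: sigma_algebra_measurable.
move=> B [] [u _]; last exact: gen.
by move=> [[]|]; exact: gen.
Qed.

Lemma measurable_history_generated E U V d (Y : measurableType d)
    (X : T -> Y) : generated_by X `<=` history_generators E U V ->
  measurable_fun [set: history_space E U V] (X : history_space E U V -> Y).
Proof.
move=> XG _ B mB; apply: sub_sigma_algebra; apply: XG.
by exists B.
Qed.

Lemma measurable_history_born E U V u : U u ->
  measurable_fun [set: history_space E U V] (born E u : history_space E U V -> bool).
Proof.
by move=> Uu; apply: measurable_history_generated => A ?; left; exists u => //; left; left.
Qed.

Lemma measurable_history_time E U V u : U u ->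
  measurable_fun [set: history_space E U V] (time E u : history_space E U V -> R).
Proof.
by move=> Uu; apply: measurable_history_generated => A ?; left; exists u => //; left; right.
Qed.

Lemma measurable_history_loc E U V u : U u ->
  measurable_fun [set: history_space E U V] (loc E u : history_space E U V -> R).
Proof.
by move=> Uu; apply: measurable_history_generated => A ?; left; exists u => //; right.
Qed.

Lemma measurable_history_mark E U V u : V u ->
  measurable_fun [set: history_space E U V] (mark E u : history_space E U V -> M).
Proof.
by move=> Vu; apply: measurable_history_generated => A ?; right; exists u.
Qed.

End history.

(** * Offspring as a random measure *)

Section offspring_measure.
Context {R : realType} {dT dM : measure_display} {T : measurableType dT}
  {M : measurableType dM}.
Variables (E : events T M R) (u : seq nat).

Let plane : measurableType _ := (measurableTypeR R * measurableTypeR R)%type.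

Let position v w : plane := (time E v w, loc E v w).

Definition offspring_atom (w : T) (i : nat) : {measure set plane -> \bar R} :=
  if born E (rcons u i) w
  then (\d_(position (rcons u i) w) : {measure set plane -> \bar R})
  else (mzero : {measure set plane -> \bar R}).

(** [offspring] is a bare function of sets. As a series of Dirac masses over the potential children
    it becomes a measure, against which functions can be integrated. *)
Definition offspring_measure (w : T) : {measure set plane -> \bar R} :=
  mseries (offspring_atom w) 0.

Lemma offspring_measureE w C : offspring E u w C = offspring_measure w C.
Proof.
transitivity (\sum_(i <oo) offspring_atom w i C); last by [].
rewrite /offspring esum_mkcond nneseries_esumT//.
apply: eq_esum => i _; rewrite /offspring_atom.
have [bi|bi] := boolP (born E (rcons u i) w).
  rewrite /= diracE; have [Ci|Ci] := pselect (C (position (rcons u i) w)).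
    by rewrite !mem_set.
  by rewrite !memNset// => -[].
by rewrite memNset// => -[bi']; rewrite bi' in bi.
Qed.

Lemma offspring_natP w C :
  offspring E u w C = +oo \/ exists n : nat, offspring E u w C = n%:R%:E.
Proof.
pose A := [set i | born E (rcons u i) w /\ C (position (rcons u i) w)].
rewrite -/A (_ : offspring E u w C = counting A).
  rewrite /counting; case: asboolP => _; last by left.
  by right; eexists.
rewrite counting_dirac nneseries_esumT//.
rewrite /offspring esum_mkcond; apply: eq_esum => i _.
by rewrite diracE; case: ifP.
Qed.

Lemma measurable_offspring C : measurable C ->
  measurable_fun setT (fun w => offspring E u w C).
Proof.
move=> mC; under eq_fun do rewrite offspring_measureE.
apply: ge0_emeasurable_sum => // i _.
rewrite (_ : (fun w => _) = fun w => if born E (rcons u i) w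
    then (\1_C (position (rcons u i) w))%:E else 0); last first.
  by apply/funext => w; rewrite /offspring_atom; case: ifP.
apply: measurable_fun_ifT => //.
apply/measurable_EFinP; apply: measurableT_comp => //.
have mpos : measurable_fun setT
    (fun w => (time E (rcons u i) w, loc E (rcons u i) w)).
  exact: measurable_fun_pair.
exact: mpos.
Qed.

Lemma integral_offspring w (F : R * R -> \bar R) : measurable_fun setT F ->
  (forall z, 0 <= F z) ->
  \int[offspring_measure w]_z F z =
  \esum_(i in [set: nat]) if born E (rcons u i) w
    then F (time E (rcons u i) w, loc E (rcons u i) w) else 0.
Proof.
move=> mF F0; rewrite ge0_integral_measure_series// nneseries_esumT//; last first.
  by move=> i; exact: integral_ge0.
apply: eq_esum => i _; rewrite /offspring_atom; case: ifP => _.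
  by rewrite integral_dirac// diracT mul1e.
by rewrite integral_measure_zero.
Qed.

End offspring_measure.

Lemma esum_children (R : realType) n (a : seq nat -> \bar R) :
  (forall v, 0 <= a v) ->
  \esum_(v in generation n.+1) a v =
  \esum_(u in generation n) \esum_(i in [set: nat]) a (rcons u i).
Proof.
move=> a0; rewrite esum_esum//.
rewrite (@reindex_esum _ _ _ (generation n `*`` fun=> setT) _
  (fun k => rcons k.1 k.2))//.
split.
- by move=> [u i] [/= un _]; rewrite /generation/= size_rcons un.
- by move=> [u i] [v j] _ _ /= /rcons_inj[-> ->].
- move=> v; rewrite /generation/=; case/lastP: v => // u i.
  by rewrite size_rcons => -[un]; exists (u, i).
Qed.

Lemma esum_before (R : realType) n (a : seq nat -> \bar R) :
  (forall v, 0 <= a v) ->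
  \esum_(v in before n.+1) a v =
  \esum_(v in before n) a v + \esum_(v in generation n) a v.
Proof.
move=> a0; rewrite (esumID (before n))//; congr (_ + _).
  congr esum; apply/seteqP; split=> v; rewrite /before/=; first by case.
  by move=> vn; split=> //; exact: ltnW.
congr esum; apply/seteqP; split=> v; rewrite /before /generation/=.
  by rewrite ltnS => -[vn /negP]; rewrite -leqNgt => nv; apply/eqP; rewrite eqn_leq vn.
by move=> ->; split=> //; rewrite ltnn.
Qed.

(** * Laplace functional of the next generation *)

Section poisson_step.
Context {R : realType} {dT dM : measure_display} {T : measurableType dT}
  {M : measurableType dM}.
Variables (P : probability T R) (E : events T M R) (n : nat).
Let X := history_space E (up_to n) (up_to n).
Variables (nu : seq nat -> T -> set (R * R) -> \bar R)
  (rho : seq nat -> X * (R * R) -> \bar R).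
Hypotheses (mrho : forall u, generation n u -> measurable_fun setT (rho u))
  (rho0 : forall u z, 0 <= rho u z)
  (rho_fin : forall u z, rho u z \is a fin_num)
  (nuE : forall u w C, generation n u -> measurable C ->
     nu u w C = \int[leb R \x leb R]_(z in C) rho u (w, z)).
Hypothesis pois :
  poisson_given P (history E (up_to n) (up_to n)) (generation n) (offspring E) nu.

(** For finitely many parents and the indicator of a history event this is [poisson_laplace];
    [weighted_law_unique] replaces the indicator by [H], and [esum_laplace_eq] reaches all parents
    of generation n. *)
Lemma laplace_next_generation (H : X -> \bar R) (F : R * R -> \bar R) :
  measurable_fun setT H -> (forall w, 0 <= H w <= 1) ->
  measurable_fun setT F -> (forall z, 0 <= F z) ->
  \int[P]_w (H w * expeR (- \esum_(v in generation n.+1)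
    if born E v w then F (time E v w, loc E v w) else 0)) =
  \int[P]_w (H w * expeR (- \esum_(u in generation n)
    \int[leb R \x leb R]_z ((1 - expeR (- F z)) * rho u (w, z)))).
Proof.
move=> mH H01 mF F0.
have mid := @measurable_to_history _ _ _ _ _ E (up_to n) (up_to n).
have mHT : measurable_fun [set: T] (H : T -> \bar R).
  exact: (measurableT_comp mH mid).
(* [rho u] is known to be measurable only for labels of generation n, and on the coarser space;
   [rho'] is measurable over T for every label. *)
pose rho' u : T * (R * R) -> \bar R :=
  if u \in generation n then rho u else cst 0.
have mrho' u : measurable_fun setT (rho' u).
  rewrite /rho'; case: ifPn => // /set_mem un.
  pose h (z : T * (R * R)) := (to_history E (up_to n) (up_to n) z.1, z.2).
  rewrite (_ : rho u = rho u \o h); last by apply/funext => -[].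
  apply: (measurableT_comp (f := rho u)); first exact: mrho.
  by apply: measurable_fun_pair => //; exact: measurableT_comp.
have rho'0 u z : 0 <= rho' u z by rewrite /rho'; case: ifP.
have rho'fin u z : rho' u z \is a fin_num by rewrite /rho'; case: ifP.
pose N u w := offspring_measure E u w.
pose c1 u w := \int[N u w]_z F z.
pose c2 u w := \int[leb R \x leb R]_z ((1 - expeR (- F z)) * rho' u (w, z)).
have eF1 z : 0 <= 1 - expeR (- F z) by rewrite subre_ge0// expeRN_le1.
have meF : measurable_fun setT (fun z => 1 - expeR (- F z)).
  apply: emeasurable_funB => //; apply: measurableT_comp.
    exact: measurable_expeR.
  exact: measurableT_comp.
have c10 u w : 0 <= c1 u w by exact: integral_ge0.
have c20 u w : 0 <= c2 u w by apply: integral_ge0 => z _; rewrite mule_ge0.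
have mN u C : measurable C -> measurable_fun setT (N u ^~ C).
  move=> mC; rewrite /N; under eq_fun do rewrite -offspring_measureE.
  exact: measurable_offspring.
have mc1 u : measurable_fun setT (c1 u).
  exact: (measurable_fun_integral_kernel (l := N u) (mN u) F0 mF).
have mc2 u : measurable_fun setT (c2 u).
  apply: (measurable_fun_integral_leb2
    (k := fun x : T * (R * R) => (1 - expeR (- F x.2)) * rho' u x)).
    by move=> x; rewrite mule_ge0.
  apply: emeasurable_funM => //.
  exact: (measurableT_comp meF).
transitivity (\int[P]_w (H w * expeR (- \esum_(u in generation n) c1 u w))).
  apply: eq_integral => w _; congr (_ * expeR (- _)).
  rewrite esum_children; last by move=> v; case: ifP.
  by apply: eq_esum => u _; rewrite /c1 integral_offspring.
transitivity (\int[P]_w (H w * expeR (- \esum_(u in generation n) c2 u w))); last first.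
  apply: eq_integral => w _; congr (_ * expeR (- _)).
  by apply: eq_esum => u un; rewrite /c2/rho' mem_set.
apply: (esum_laplace_eq (c1 := c1) (c2 := c2) mHT mHT H01 H01).
- by move=> u w _; exact: c10.
- by move=> u w _; exact: c20.
- by move=> u _; exact: mc1.
- by move=> u _; exact: mc2.
move=> s us sI.
pose Y (c : seq nat -> T -> \bar R) w := expeR (- \sum_(u <- s) c u w).
have Y01 c : (forall u w, 0 <= c u w) -> forall w, 0 <= Y c w <= 1.
  by move=> c0 w; rewrite expeR_ge0 expeRN_le1// sume_ge0.
have mY c : (forall u, measurable_fun setT (c u)) -> measurable_fun setT (Y c).
  move=> mc; apply: measurableT_comp; first exact: measurable_expeR.
  by apply: measurableT_comp => //; exact: emeasurable_sum.
suff : \int[P]_w (Y c1 w * H (to_history E (up_to n) (up_to n) w)) =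
    \int[P]_w (Y c2 w * H (to_history E (up_to n) (up_to n) w)).
  by under eq_integral do rewrite muleC;
    under [in X in _ = X -> _]eq_integral do rewrite muleC.
have H0 w : 0 <= H w by have /andP[] := H01 w.
apply: (weighted_law_unique mid (mY c1 mc1) (mY c2 mc2) (Y01 c1 c10)
  (Y01 c2 c20) _ H0 mH).
move=> A mA; rewrite preimage_id.
have mAT : (measurable : set (set T)) A.
  have := @measurable_to_history _ _ _ _ _ E (up_to n) (up_to n) measurableT A mA.
  by rewrite setTI preimage_id.
apply: (@poisson_laplace _ _ T (measurableTypeR R * measurableTypeR R)%type _
    P (leb R \x leb R) _ (generation n) N rho' A mN _ mrho' rho'0 rho'fin mAT).
- move=> u C w mC; rewrite -[N u w C]offspring_measureE.
  exact: offspring_natP.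
- by move=> k k0 mk; exact: measurable_fun_integral_leb2.
- move=> m i C k Ii mC dC; rewrite -[RHS](_ : \int[P]_(w in A)
      \prod_(a < m) poisson_mass (nu (i a) w (C a)) (k a) = _); last first.
    apply: eq_integral => w _; apply: eq_bigr => a _.
    rewrite (nuE _ (Ii a) (mC a)) /rho' ifT//.
    by rewrite inE; exact: Ii.
  rewrite -pois//; congr (P (_ `&` _)); apply/seteqP.
  by split=> w /= h a; rewrite -h offspring_measureE.
- exact: F0.
- exact: mF.
- exact: us.
- exact: sI.
Qed.

End poisson_step.

(** * Removal of one generation *)

Section generation_recursion.
Context {R : realType} {dT dM : measure_display} {T : measurableType dT}
  {M : measurableType dM}.
Variables (P : probability T R) (PB : probability M R) (E : events T M R).
Variables (rate : (M * R) * (R * R) -> R) (g : R * R -> \bar R) (t : R).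
Hypotheses (mrate : measurable_fun setT rate) (rate0 : forall z, (0 <= rate z)%R)
  (mg : measurable_fun setT g) (g01 : forall z, 0 <= g z <= 1).
Implicit Types G : R * R -> \bar R.

(* Minus logarithms, with value +oo where G vanishes, turn the products over
   the born labels into sums. *)
Definition score G u w : \bar R :=
  if born E u w then - lne (G ((t - time E u w)%R, loc E u w)) else 0.

Lemma score_ge0 G u w : (forall z, 0 <= G z <= 1) -> 0 <= score G u w.
Proof.
move=> G01; rewrite /score; case: ifP => // _; apply: lneN_ge0.
by have /andP[] := G01 ((t - time E u w)%R, loc E u w).
Qed.

Lemma expeRN_score G u w : (forall z, 0 <= G z <= 1) ->
  expeR (- score G u w) =
  if born E u w then G ((t - time E u w)%R, loc E u w) else 1.
Proof.
move=> G01; rewrite /score; case: ifP => _; last by rewrite oppe0 expeR0.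
by rewrite expeRN_lne//; have /andP[] := G01 ((t - time E u w)%R, loc E u w).
Qed.

Section history_measurability.
Variables U V : set (seq nat).
Let X := history_space E U V.

Lemma measurable_history_position u : U u ->
  measurable_fun [set: X] (fun w : X => ((t - time E u w)%R, loc E u w)).
Proof.
move=> Uu; apply: measurable_fun_pair; last exact: measurable_history_loc.
by apply: measurable_funB => //; exact: measurable_history_time.
Qed.

Lemma measurable_score G u : measurable_fun setT G -> U u ->
  measurable_fun [set: X] (score G u : X -> \bar R).
Proof.
move=> mG Uu; apply: measurable_fun_ifT => //.
  exact: measurable_history_born.
apply: measurableT_comp => //; apply: measurableT_comp.
  exact: measurable_lne.
by apply: (measurableT_comp mG); exact: measurable_history_position.
Qed.

Lemma measurable_expeRN_esum_score G W : measurable_fun setT G ->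
  (forall z, 0 <= G z <= 1) -> W `<=` U ->
  measurable_fun [set: X]
    ((fun w => expeR (- \esum_(u in W) score G u w)) : X -> \bar R).
Proof.
move=> mG G01 WU; apply: measurableT_comp; first exact: measurable_expeR.
apply: measurableT_comp => //.
apply: (measurable_esum (c := (score G : seq nat -> X -> \bar R))).
  by move=> u w _; exact: score_ge0.
by move=> u Wu; apply: measurable_score => //; exact: WU.
Qed.

End history_measurability.

Lemma expeRN_esum_score01 G W w : (forall z, 0 <= G z <= 1) ->
  0 <= expeR (- \esum_(u in W) score G u w) <= 1.
Proof.
move=> G01; rewrite expeR_ge0 expeRN_le1//.
by apply: esum_ge0 => u _; exact: score_ge0.
Qed.

Let of_history U V (h : history_space E U V -> \bar R) : measurable_fun setT h ->
  measurable_fun [set: T] (h : T -> \bar R).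
Proof.
move=> mh; apply: (measurableT_comp (f := h) (g := to_history E U V)) => //.
exact: measurable_to_history.
Qed.

Section marks.
Variables (n : nat) (G : R * R -> \bar R).
Hypotheses (mG : measurable_fun setT G) (G01 : forall z, 0 <= G z <= 1).
Hypothesis marks : independent_marks P PB E.
Let X := history_space E (up_to n) (before n).

(** Minus the logarithm of the Laplace functional of the children of [u], each carrying the factor
    [G], given the history and the mark of [u]. *)
Definition mark_exponent u w : \bar R := if born E u w
  then offspring_exponent rate G (mark E u w, ((t - time E u w)%R, loc E u w))
  else 0.

Let mark_exponent_ge0 u w : 0 <= mark_exponent u w.
Proof. by rewrite /mark_exponent; case: ifP => // _; exact: offspring_exponent_ge0. Qed.

Lemma measurable_mark_exponent u : measurable_fun [set: T] (mark_exponent u).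
Proof.
apply: measurable_fun_ifT => //.
apply: measurableT_comp; first exact: measurable_offspring_exponent.
apply: measurable_fun_pair => //; apply: measurable_fun_pair => //.
exact: measurable_funB.
Qed.

(** The second component of z is a free mark, which replaces [mark E u]; the value 1 at unborn
    labels is the condition [kNb] of [conditional_independence]. *)
Let k u (z : X * M) : \bar R := if born E u z.1
  then g ((t - time E u z.1)%R, loc E u z.1) *
       expeR (- offspring_exponent rate G
                  (z.2, ((t - time E u z.1)%R, loc E u z.1)))
  else 1.

(** The history [X] contains the times and locations of generation n but not its marks. The factor
    [g] of an event therefore leaves the integral over its mark, and what remains is
    [generation_step]. *)
Lemma laplace_marks (H : X -> \bar R) :
  measurable_fun setT H -> (forall w, 0 <= H w <= 1) ->
  \int[P]_w (H w * expeR (- \esum_(u in generation n)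
     (score g u w + mark_exponent u w))) =
  \int[P]_w (H w * expeR (- \esum_(u in generation n)
     score (generation_step PB rate g G) u w)).
Proof.
move=> mH H01.
have gen_up u : generation n u -> up_to n u.
  by rewrite /generation /up_to/= => ->.
pose G' := generation_step PB rate g G.
have mG' : measurable_fun setT G'.
  exact: (measurable_generation_step PB mrate rate0 mg mG G01).
have G'01 z : 0 <= G' z <= 1.
  have /andP[/= -> le_g] := generation_step_itv01 PB mrate rate0 g01 mG G01 z.
  by have /andP[_] := g01 z; apply: le_trans.
have mHT := of_history mH.
pose c1 u w := score g u w + mark_exponent u w.
pose c2 u w := score G' u w.
have mscore F u : measurable_fun setT F -> measurable_fun [set: T] (score F u).
  by move=> mF; apply: (of_history (U := setT) (V := setT)); exact: measurable_score.
have c10 u w : 0 <= c1 u w by rewrite adde_ge0// score_ge0.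
have c20 u w : 0 <= c2 u w by exact: score_ge0.
have mc1 u : measurable_fun setT (c1 u).
  by apply: emeasurable_funD; [exact: mscore|exact: measurable_mark_exponent].
have mc2 u : measurable_fun setT (c2 u) by exact: mscore.
apply: (esum_laplace_eq (c1 := c1) (c2 := c2) mHT mHT H01 H01).
- by move=> u w _; exact: c10.
- by move=> u w _; exact: c20.
- by move=> u _; exact: mc1.
- by move=> u _; exact: mc2.
move=> s us sI.
have mcstPB : measurable_fun [set: X] (fun=> PB : pprobability M R).
  exact: measurable_cst.
pose K : R.-pker X ~> M := kprobability mcstPB.
have k01 u z : 0 <= k u z <= 1.
  rewrite /k; case: ifP => // _; last by rewrite lee01 lexx.
  have /andP[g0 g1] := g01 ((t - time E u z.1)%R, loc E u z.1).
  rewrite mule_ge0 ?expeR_ge0//= -[leRHS]mule1 lee_pmul ?expeR_ge0//.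
  by rewrite expeRN_le1// offspring_exponent_ge0.
have mk u : generation n u -> measurable_fun setT (k u).
  move=> /gen_up un; have mpos := measurable_history_position (V := before n) un.
  have mpos1 : measurable_fun [set: X * M]
      (fun z => ((t - time E u z.1)%R, loc E u z.1)).
    exact: (measurableT_comp mpos measurable_fst).
  apply: measurable_fun_ifT.
  - apply: (measurableT_comp (f := (born E u : X -> bool))) => //.
    exact: measurable_history_born.
  - apply: emeasurable_funM; first exact: measurableT_comp.
    apply: measurableT_comp; first exact: measurable_expeR.
    apply: measurableT_comp => //; apply: measurableT_comp.
      exact: measurable_offspring_exponent.
    exact: measurable_fun_pair.
  - exact: measurable_cst.
have E1 w : expeR (- \sum_(u <- s) c1 u w) =
    \prod_(u <- s) k u (to_history E (up_to n) (before n) w, mark E u w).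
  rewrite expeRN_sum; last by move=> u _; exact: c10.
  apply: eq_bigr => u _; rewrite /c1 expeRND ?score_ge0// expeRN_score//.
  rewrite /k /mark_exponent /= /to_history.
  by case: ifP => // _; rewrite oppe0 expeR0 mule1.
have E2 w : expeR (- \sum_(u <- s) c2 u w) =
    \prod_(u <- s) \int[K w]_m k u (to_history E (up_to n) (before n) w, m).
  rewrite expeRN_sum; last by move=> u _; exact: c20.
  apply: eq_bigr => u _; rewrite /c2 expeRN_score// /k /= /to_history.
  case: ifP => bu; last first.
    by rewrite integral_cst//= mul1e; apply/esym; exact: probability_setT.
  rewrite ge0_integralZl//.
  - exact: measurable_expeRN_offspring.
  - by move=> m _; exact: expeR_ge0.
  - by have /andP[] := g01 ((t - time E u w)%R, loc E u w).
under eq_integral do rewrite E1.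
under [RHS]eq_integral do rewrite E2.
apply: (@conditional_independence _ _ _ T X M _ P
  (to_history E (up_to n) (before n)) (@measurable_to_history _ _ _ _ _ _ _ _)
  _ (generation n) (fun u => [set w : X | born E u w])
  (fun u w => mark E u w) (fun=> K) _ _ _ k k01 mk _ s H us sI H01 mH).
- move=> u /gen_up un; have mbu := measurable_history_born (E := E) (V := before n) un.
  by rewrite -[X in measurable X]setTI; exact: (mbu measurableT [set true]).
- by move=> u; exact: measurable_funP.
- move=> A s' C mA us' s'I Ab mC.
  rewrite preimage_id; have -> := @marks n A s' C mA us' s'I Ab mC.
  transitivity (\int[P]_(w in A) cst (\prod_(u <- s') PB (C u)) w); last by [].
  rewrite integral_cst; first by rewrite muleC.
  have := @measurable_to_history _ _ _ _ _ E (up_to n) (before n) measurableT A mA.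
  by rewrite setTI preimage_id.
- by move=> u w m /negP; rewrite /k/= => /negbTE ->.
Qed.

End marks.
Definition offspring_rate u w (z : R * R) : \bar R := if born E u w
  then (rate ((mark E u w, loc E u w), ((z.1 - time E u w)%R, z.2)))%:E else 0.

Section step.
Variables (n : nat) (G : R * R -> \bar R).
Variable nu : seq nat -> T -> set (R * R) -> \bar R.
Hypotheses (mG : measurable_fun setT G) (G01 : forall z, 0 <= G z <= 1).
Hypotheses (marks : independent_marks P PB E)
  (nuE : forall u w C, generation n u -> measurable C ->
     nu u w C = \int[leb R \x leb R]_(z in C) offspring_rate u w z)
  (pois : poisson_given P (history E (up_to n) (up_to n)) (generation n)
            (offspring E) nu).
Let X := history_space E (up_to n) (up_to n).

(** The intensity is written in absolute time and [G] in the time left before t; reflecting time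
    about t reconciles the two. *)
Let integral_offspring_rate u w :
  \int[leb R \x leb R]_z
    ((1 - expeR (- - lne (G ((t - z.1)%R, z.2)))) * offspring_rate u w z) =
  mark_exponent G u w.
Proof.
have eG z : expeR (- - lne (G z)) = G z.
  by apply: expeRN_lne; have /andP[] := G01 z.
under eq_integral do rewrite eG.
rewrite /offspring_rate /mark_exponent; case: ifP => _; last first.
  by apply: integral0_eq => z _; rewrite mule0.
rewrite /offspring_exponent /= -[RHS](ge0_integral_reflect2 t).
- apply: eq_integral => z _ /=.
  rewrite (_ : (t - time E u w - (t - z.1))%R = (z.1 - time E u w)%R)//.
  by ring.
- exact: (measurable_offspring_integrand mrate
    (mark E u w, ((t - time E u w)%R, loc E u w)) mG).
- move=> z; have /andP[G0 G1] := G01 z; rewrite mule_ge0 ?lee_fin//.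
  by rewrite subre_ge0.
Qed.

Lemma laplace_generation_step :
  \int[P]_w expeR (- (\esum_(u in before n.+1) score g u w +
                      \esum_(u in generation n.+1) score G u w)) =
  \int[P]_w expeR (- (\esum_(u in before n) score g u w +
                      \esum_(u in generation n)
                        score (generation_step PB rate g G) u w)).
Proof.
have sum0 F W w : (forall z, 0 <= F z <= 1) -> 0 <= \esum_(u in W) score F u w.
  by move=> F01; apply: esum_ge0 => u _; exact: score_ge0.
have G'01 z : 0 <= generation_step PB rate g G z <= 1.
  have /andP[/= -> le_g] := generation_step_itv01 PB mrate rate0 g01 mG G01 z.
  by have /andP[_] := g01 z; apply: le_trans.
under eq_integral do rewrite expeRND ?sum0//.
under [RHS]eq_integral do rewrite expeRND ?sum0//.
(* Two histories are in play. The Poisson step conditions on the marks of generation n, the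
   integration over these marks must not; so generation n belongs to the weight [H1] but not to
   [H2]. *)
pose H1 : X -> \bar R := fun w => expeR (- \esum_(u in before n.+1) score g u w).
pose H2 : history_space E (up_to n) (before n) -> \bar R :=
  fun w => expeR (- \esum_(u in before n) score g u w).
pose F (z : R * R) := - lne (G ((t - z.1)%R, z.2)).
have mF : measurable_fun setT F.
  apply: measurableT_comp => //; apply: measurableT_comp.
    exact: measurable_lne.
  apply: measurableT_comp => //; apply: measurable_fun_pair => //.
  exact: measurable_funB.
have F0 z : 0 <= F z.
  by apply: lneN_ge0; have /andP[] := G01 ((t - z.1)%R, z.2).
pose rho u (x : X * (R * R)) := offspring_rate u x.1 x.2.
have mrho u : generation n u -> measurable_fun setT (rho u).
  move=> un; have {}un : up_to n u by move: un; rewrite /generation /up_to/= => ->.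
  apply: measurable_fun_ifT => //.
    apply: (measurableT_comp (f := (born E u : X -> bool))) => //.
    exact: measurable_history_born.
  apply/measurable_EFinP; apply: (measurableT_comp mrate).
  apply: measurable_fun_pair; apply: measurable_fun_pair.
  - apply: (measurableT_comp (f := (mark E u : X -> M))) => //.
    exact: measurable_history_mark.
  - apply: (measurableT_comp (f := (loc E u : X -> R))) => //.
    exact: measurable_history_loc.
  - apply: measurable_funB; first exact: measurableT_comp.
    apply: (measurableT_comp (f := (time E u : X -> R))) => //.
    exact: measurable_history_time.
  - exact: measurableT_comp.
have rho0 u x : 0 <= rho u x.
  by rewrite /rho /offspring_rate; case: ifP => // _; rewrite lee_fin.
have rho_fin u x : rho u x \is a fin_num.
  by rewrite /rho /offspring_rate; case: ifP.
have mH1 : measurable_fun setT H1.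
  by apply: measurable_expeRN_esum_score.
have mH2 : measurable_fun setT H2.
  by apply: measurable_expeRN_esum_score => //; move=> u /ltnW.
have H101 w : 0 <= H1 w <= 1 by exact: expeRN_esum_score01.
have H201 w : 0 <= H2 w <= 1 by exact: expeRN_esum_score01.
have := laplace_next_generation mrho rho0 rho_fin nuE pois mH1 H101 mF F0.
move=> ->.
rewrite -(laplace_marks mG G01 marks mH2 H201).
(* The scores of generation n are taken out of [H1] and joined to the exponents of their offspring:
   together they form the integrand of [laplace_marks]. *)
apply: eq_integral => w _; rewrite /H1 esum_before; last first.
  by move=> v; exact: score_ge0.
rewrite expeRND ?sum0// -muleA; congr (_ * _).
rewrite esumD; last 2 first.
- by move=> u _; exact: score_ge0.
- move=> u _; rewrite /mark_exponent; case: ifP => // _.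
  exact: offspring_exponent_ge0.
rewrite expeRND ?sum0//; last first.
  apply: esum_ge0 => u _; rewrite /mark_exponent; case: ifP => // _.
  exact: offspring_exponent_ge0.
by congr (_ * expeR (- _)); apply: eq_esum => u _; exact: integral_offspring_rate.
Qed.

End step.

End generation_recursion.

(** * Integration over the lifetimes *)

Section lifetimes.
Context {R : realType} {dT dM : measure_display} {T : measurableType dT}
  {M : measurableType dM}.
Variables (P : probability T R) (E : events T M R).
Context {dJ : measure_display} {V : measurableType dJ}.
Variables (PJ : probability V R) (J : R -> V -> R) (law : R.-pker R ~> R).
Variables (f fR : R -> R) (t : R).
Hypotheses (lawE : forall x C, I01 x -> measurable C -> law x C = PJ (J x @^-1` C))
  (mf : measurable_fun setT fR) (f0 : forall x, (0 <= fR x)%R)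
  (fE : forall x, I01 x -> f x = fR x).
Hypothesis lifetimes : independent_lifetimes P PJ J E.

(** Not a survival probability: it is the mean, over the lifetime l, of the factor of one event
    whose age at the observation time is [z.1]. An event that is dead or still to come counts for
    1. *)
Definition survival (z : R * R) : \bar R :=
  \int[law z.2]_l (if (0 <= z.1)%R && (z.1 < l)%R then (expR (- fR z.2))%:E else 1).

Let survival_integrand01 (z : R * R) l :
  0 <= (if (0 <= z.1)%R && (z.1 < l)%R then (expR (- fR z.2))%:E else 1) <= 1.
Proof.
case: ifP => _; last by rewrite lee01 lexx.
by rewrite !lee_fin expR_ge0 expR_le1 oppr_le0/=.
Qed.

Let measurable_survival_integrand : measurable_fun [set: (R * R) * R]
  (fun x => if (0 <= x.1.1)%R && (x.1.1 < x.2)%R then (expR (- fR x.1.2))%:E else 1 : \bar R).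
Proof.
have m1 : measurable_fun [set: (R * R) * R] (fun x => x.1.1) by exact: measurableT_comp.
have m2 : measurable_fun [set: (R * R) * R] (fun x => x.1.2) by exact: measurableT_comp.
apply: measurable_fun_ifT => //.
  apply: measurable_and; first exact: measurable_fun_ler.
  exact: measurable_fun_ltr.
apply/measurable_EFinP; apply: measurableT_comp => //.
by apply: measurableT_comp => //; exact: measurableT_comp.
Qed.

Lemma survival_itv01 z : 0 <= survival z <= 1.
Proof.
rewrite integral_ge0/=; last by move=> l _; have /andP[] := survival_integrand01 z l.
rewrite -(@prob_kernel _ _ _ _ _ law z.2) -[leRHS]mul1e -integral_cst//.
apply: ge0_le_integral => //.
- by move=> l _; have /andP[] := survival_integrand01 z l.
- exact: (measurableT_comp measurable_survival_integrand (pair1_measurable z)).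
- by move=> l _; have /andP[] := survival_integrand01 z l.
Qed.

Lemma measurable_survival : measurable_fun setT survival.
Proof.
pose K : R.-pker (R * R)%type ~> R := kpre law (@measurable_snd _ _ R R).
apply: (measurable_fun_integral_finite_kernel (fun x : (R * R) * R =>
  if (0 <= x.1.1)%R && (x.1.1 < x.2)%R then (expR (- fR x.1.2))%:E else 1) K) => //.
by move=> x; have /andP[] := survival_integrand01 x.1 x.2.
Qed.

Lemma survival_lt0 r x : (r < 0)%R -> survival (r, x) = 1.
Proof.
move=> r0; rewrite /survival (eq_integral (cst 1)).
  by rewrite integral_cst// mul1e prob_kernel.
by move=> l _ /=; rewrite leNgt r0.
Qed.

Let alive_label u w l :=
  [&& born E u w, (time E u w <= t)%R & (t < time E u w + l)%R].

(** The set of alive labels is random. Summing over all labels, with zero terms for those not alive,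
    fixes the index set, and the lifetimes are then integrated label by label given the full
    history. *)
Lemma laplace_survival :
  laplace P E f t = \int[P]_w expeR (- \esum_(u in setT) score E t survival u w).
Proof.
pose c1 u w : \bar R := if alive_label u w (life E u w)
  then (fR (loc E u w))%:E else 0.
pose c2 u w : \bar R := score E t survival u w.
transitivity (\int[P]_w (cst 1 w * expeR (- \esum_(u in setT) c1 u w))).
  apply: eq_integral => w _; rewrite mul1e; congr (expeR (- _)).
  rewrite esum_mkcond; apply: eq_esum => u _; rewrite /c1.
  rewrite (_ : (u \in alive E t w) = alive_label u w (life E u w)); last first.
    apply/idP/idP; rewrite inE /alive_label.
      by move=> [bu al]; apply/andP.
    by move=> /and3P[bu tl tr]; split=> //; rewrite tl.
  case: ifP => // /and3P[bu _ _]; rewrite fE//; exact: (loc_I01 bu).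
transitivity (\int[P]_w (cst 1 w * expeR (- \esum_(u in setT) c2 u w))); last first.
  by apply: eq_integral => w _; rewrite mul1e.
have c10 u w : 0 <= c1 u w by rewrite /c1; case: ifP => // _; rewrite lee_fin.
have c20 u w : 0 <= c2 u w by apply: score_ge0; exact: survival_itv01.
have mal u : measurable_fun [set: T] (fun w => alive_label u w (life E u w)).
  apply: measurable_and => //; apply: measurable_and.
    exact: measurable_fun_ler.
  by apply: measurable_fun_ltr => //; exact: measurable_funD.
have mc1 u : measurable_fun setT (c1 u).
  apply: measurable_fun_ifT => //; apply/measurable_EFinP.
  exact: measurableT_comp.
have mc2 u : measurable_fun setT (c2 u).
  have ms := measurable_score (V := setT) (U := setT) (E := E) t measurable_survival (u := u) I.
  exact: (measurableT_comp ms (@measurable_to_history _ _ _ _ _ E setT setT)).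
have one01 (X : Type) (w : X) : 0 <= (cst 1 w : \bar R) <= 1 by rewrite /= lee01 lexx.
apply: (esum_laplace_eq (c1 := c1) (c2 := c2) (measurable_cst _) (measurable_cst _)
  (one01 _) (one01 _)).
- by move=> u w _; exact: c10.
- by move=> u w _; exact: c20.
- by move=> u _; exact: mc1.
- by move=> u _; exact: mc2.
move=> s us _.
pose X := history_space E setT setT.
have mloc u : measurable_fun [set: X] (loc E u : X -> R).
  exact: measurable_history_loc.
pose K u : R.-pker X ~> R := kpre law (mloc u).
pose k u (z : X * R) : \bar R := if alive_label u z.1 z.2
  then (expR (- fR (loc E u z.1)))%:E else 1.
have k01 u z : 0 <= k u z <= 1.
  rewrite /k; case: ifP => _; last by rewrite lee01 lexx.
  by rewrite !lee_fin expR_ge0 expR_le1 oppr_le0/=.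
have mk u : setT u -> measurable_fun setT (k u).
  move=> _; apply: measurable_fun_ifT => //.
    apply: measurable_and; [|apply: measurable_and].
    - apply: (measurableT_comp (f := (born E u : X -> bool))) => //.
      exact: measurable_history_born.
    - apply: measurable_fun_ler => //.
      apply: (measurableT_comp (f := (time E u : X -> R))) => //.
      exact: measurable_history_time.
    - apply: measurable_fun_ltr => //; apply: measurable_funD => //.
      apply: (measurableT_comp (f := (time E u : X -> R))) => //.
      exact: measurable_history_time.
  apply/measurable_EFinP; apply: measurableT_comp => //.
  apply: measurableT_comp => //; apply: measurableT_comp => //.
  exact: (measurableT_comp (mloc u)).
have E1 w : expeR (- \sum_(u <- s) c1 u w) =
    \prod_(u <- s) k u (to_history E setT setT w, life E u w).
  rewrite expeRN_sum; last by move=> u _; exact: c10.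
  apply: eq_bigr => u _; rewrite /c1 /k /= /to_history.
  by case: ifP => // _; rewrite oppe0 expeR0.
have E2 w : expeR (- \sum_(u <- s) c2 u w) =
    \prod_(u <- s) \int[K u (to_history E setT setT w)]_l
       k u (to_history E setT setT w, l).
  rewrite expeRN_sum; last by move=> u _; exact: c20.
  apply: eq_bigr => u _; rewrite /c2 expeRN_score; last exact: survival_itv01.
  rewrite /k /alive_label /= /to_history; case: ifP => bu /=; last first.
    by rewrite integral_cst// mul1e prob_kernel.
  apply: eq_integral => l _ /=.
  by rewrite subr_ge0 ltrBlDl.
under eq_integral do rewrite E1.
under [RHS]eq_integral do rewrite E2.
apply: (@conditional_independence _ _ _ T X _ _ P
  (to_history E setT setT) (@measurable_to_history _ _ _ _ _ _ _ _)
  _ setT (fun u => [set w : X | born E u w])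
  (fun u w => life E u w) K _ _ _ k k01 mk _ s (cst 1)) => //.
- move=> u _; have mbu := measurable_history_born (E := E) (V := setT) (u := u) I.
  by rewrite -[X in measurable X]setTI; exact: (mbu measurableT [set true]).
- move=> A s' C mA us' s'I Ab mC.
  rewrite preimage_id; have -> := @lifetimes A s' C mA us' Ab mC.
  apply: eq_integral => w /set_mem Aw; apply: eq_big_seq => u us''.
  by rewrite -lawE//; apply: (loc_I01 (Ab w Aw u us'')).
- move=> u w l; rewrite /k /alive_label/= => /negP/negbTE -> //.
Qed.

End lifetimes.

Lemma integral_cst_probability d (T : measurableType d) (R : realType)
    (P : probability T R) (c : \bar R) : \int[P]_w cst c w = c.
Proof.
rewrite integral_cst//; transitivity (c * 1); last exact: mule1.
congr (_ * _); exact: probability_setT.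
Qed.

Lemma nondecreasing_esum_before (R : realType) (a : seq nat -> \bar R) :
  (forall v, 0 <= a v) -> nondecreasing_seq (fun n => \esum_(v in before n) a v).
Proof.
move=> a0; apply/nondecreasing_seqP => n.
by rewrite esum_before// leeDl// esum_ge0.
Qed.

(** A finite set of words has bounded length, so truncation by length exhausts the sum even though
    [before n] is infinite from n = 2 on. *)
Lemma cvg_esum_before (R : realType) (a : seq nat -> \bar R) :
  (forall v, 0 <= a v) ->
  \esum_(v in before n) a v @[n --> \oo] --> \esum_(v in setT) a v.
Proof.
move=> a0; rewrite [X in _ --> X](_ : _ =
    ereal_sup (range (fun n => \esum_(v in before n) a v))).
  exact/ereal_nondecreasing_cvgn/nondecreasing_esum_before.
apply/eqP; rewrite eq_le; apply/andP; split; last first.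
  apply: ge_ereal_sup => _ [n _ <-].
  rewrite [leRHS](esumID (before n))// setTI leeDl// esum_ge0//.
apply: ge_ereal_sup => _ [A [fA _] <-].
have /finite_seqP[s As] := fA.
pose n := (\max_(u <- s) size u).+1.
apply: (@le_trans _ _ (\esum_(v in before n) a v)); last first.
  by apply: ereal_sup_ubound; exists n.
apply: ereal_sup_ubound; exists A => //; split=> // u Au.
by rewrite /before/= ltnS leq_bigmax_seq//; move: Au; rewrite As.
Qed.

Lemma before0 : before 0 = set0.
Proof. by apply/seteqP; split. Qed.

Lemma generation0 : generation 0 = [set [::]].
Proof. by apply/seteqP; split=> [[]//|_ ->]. Qed.

(** * Truncated Laplace functionals of the cluster and of the Hawkes process *)

Section laplace_limits.
Context {R : realType} {dT dM : measure_display} {T : measurableType dT}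
  {M : measurableType dM}.
Variables (P : probability T R) (PB : probability M R) (E : events T M R).
Variables (rate : (M * R) * (R * R) -> R) (g : R * R -> \bar R) (t : R).
Hypotheses (mrate : measurable_fun setT rate) (rate0 : forall z, (0 <= rate z)%R)
  (mg : measurable_fun setT g) (g01 : forall z, 0 <= g z <= 1).
Let G n := generation_iter PB rate g n.

Let mG n : measurable_fun setT (G n).
Proof. by have [] := generation_iter_prop PB mrate rate0 mg g01 n. Qed.

Let G01 n z : 0 <= G n z <= 1.
Proof. by have [_] := generation_iter_prop PB mrate rate0 mg g01 n. Qed.

Lemma cvg_laplace_before :
  \int[P]_w expeR (- \esum_(u in before n) score E t g u w) @[n --> \oo] -->
  \int[P]_w expeR (- \esum_(u in setT) score E t g u w).
Proof.
apply: cvg_integral01 => //.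
- move=> n.
  have mX := measurable_expeRN_esum_score (U := setT) (V := setT)
    (E := E) t mg g01 (@subsetT _ (before n)).
  exact: (measurableT_comp mX (@measurable_to_history _ _ _ _ _ E setT setT)).
- by move=> n w; exact: expeRN_esum_score01.
- move=> w; apply: cvg_expeRN.
    by apply: nondecreasing_esum_before => u; exact: score_ge0.
  by apply: cvg_esum_before => u; exact: score_ge0.
Qed.

Hypothesis marks : independent_marks P PB E.

Let esum_score_before n w : \esum_(u in before n.+1) score E t g u w =
  \esum_(u in before n) score E t g u w + \esum_(u in generation n) score E t g u w.
Proof. by apply: esum_before => v; exact: score_ge0. Qed.

(** m is the first generation that reproduces with the offspring intensity: 0 for a cluster, 1 for
    the Hawkes process, whose empty word produces the immigrants. Removing the last generation
    changes the factor of the one before it, so the induction is over all [F]. *)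
Let laplace_iter (nu : seq nat -> T -> set (R * R) -> \bar R) (m n : nat) (F : R * R -> \bar R) :
  measurable_fun setT F -> (forall z, 0 <= F z <= 1) ->
  (forall i, (m <= i)%N -> poisson_given P (history E (up_to i) (up_to i))
     (generation i) (offspring E) nu) ->
  (forall i u w C, (m <= i)%N -> generation i u -> measurable C ->
     nu u w C = \int[leb R \x leb R]_(z in C) offspring_rate E rate u w z) ->
  \int[P]_w expeR (- (\esum_(u in before (n + m)) score E t g u w +
                      \esum_(u in generation (n + m)) score E t F u w)) =
  \int[P]_w expeR (- (\esum_(u in before m) score E t g u w +
    \esum_(u in generation m) score E t (iter n (generation_step PB rate g) F) u w)).
Proof.
move=> mF F01 pois nuE; elim: n F mF F01 => [//|n ih] F mF F01.
rewrite addSn (laplace_generation_step t mrate rate0 mg g01 mF F01 marks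
  (nu := nu)).
- rewrite iterSr; apply: ih.
    exact: (measurable_generation_step PB mrate rate0 mg mF F01).
  move=> z; have /andP[/= -> le_g] := generation_step_itv01 PB mrate rate0 g01 mF F01 z.
  by have /andP[_] := g01 z; apply: le_trans.
- by move=> u w C; apply: nuE; rewrite leq_addl.
- by apply: pois; rewrite leq_addl.
Qed.

(** Words of length at most n leave n generations to remove before the root, which is read at (t -
    0, x). *)
Lemma cluster_laplace_before (nu : seq nat -> T -> set (R * R) -> \bar R) x n :
  (forall w, [/\ born E [::] w, time E [::] w = 0%R & loc E [::] w = x]) ->
  reproduces P E nu ->
  (forall u w C, measurable C ->
     nu u w C = \int[leb R \x leb R]_(z in C) offspring_rate E rate u w z) ->
  \int[P]_w expeR (- \esum_(u in before n.+1) score E t g u w) = G n (t, x).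
Proof.
move=> root pois nuE.
have /andP[Gn0 Gn1] := G01 n (t, x).
transitivity (\int[P]_w (cst (G n (t, x)) w)); last first.
  exact: integral_cst_probability.
under eq_integral do rewrite esum_score_before.
have := @laplace_iter nu 0%N n g mg g01 (fun i _ => pois i)
  (fun i u w C _ _ => nuE u w C).
rewrite addn0 => ->; apply: eq_integral => w _.
rewrite before0 esum_set0 add0e generation0 esum_set1; last first.
  exact: (score_ge0 _ _ _ _ (G01 n)).
rewrite expeRN_score; last exact: (G01 n).
by have [-> -> ->] := root w; rewrite subr0.
Qed.

(** Immigrants have length 1, so words of length at most n + 1 again leave n generations to remove.
    The immigrants themselves form a Poisson process with a deterministic intensity: one last
    Poisson step, without any mark, gives a constant. *)
Lemma hawkes_laplace_before (nu : seq nat -> T -> set (R * R) -> \bar R)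
    (rho : R * R -> \bar R) n :
  measurable_fun setT rho -> (forall z, 0 <= rho z) ->
  (forall z, rho z \is a fin_num) ->
  (forall w, born E [::] w = false) ->
  reproduces P E nu ->
  (forall w C, measurable C ->
     nu [::] w C = \int[leb R \x leb R]_(z in C) rho z) ->
  (forall u w C, u != [::] -> measurable C ->
     nu u w C = \int[leb R \x leb R]_(z in C) offspring_rate E rate u w z) ->
  \int[P]_w expeR (- \esum_(u in before n.+2) score E t g u w) =
  expeR (- \int[leb R \x leb R]_z ((1 - G n ((t - z.1)%R, z.2)) * rho z)).
Proof.
move=> mrho rho0 rho_fin root pois nu0 nuE.
set rhs := expeR _.
transitivity (\int[P]_w (cst rhs w)); last first.
  exact: integral_cst_probability.
under eq_integral do rewrite esum_score_before.
have := @laplace_iter nu 1%N n g mg g01 (fun i _ => pois i).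
rewrite addn1 => ->; last first.
  move=> i u w C i0 ui; apply: nuE; apply/eqP => u0; move: ui i0.
  by rewrite /generation/= u0 => <-.
pose F (z : R * R) := - lne (G n ((t - z.1)%R, z.2)).
have mF : measurable_fun setT F.
  apply: measurableT_comp => //; apply: measurableT_comp.
    exact: measurable_lne.
  apply: (measurableT_comp (mG n)); apply: measurable_fun_pair => //.
  exact: measurable_funB.
have F0 z : 0 <= F z.
  by apply: lneN_ge0; have /andP[] := G01 n ((t - z.1)%R, z.2).
transitivity (\int[P]_w (cst 1 w * expeR (- \esum_(v in generation 1)
    if born E v w then F (time E v w, loc E v w) else 0))).
  apply: eq_integral => w _; rewrite mul1e.
  rewrite esum_score_before before0 esum_set0 add0e generation0 esum_set1; last exact: score_ge0.
  by rewrite {1}/score root add0e.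
have one01 (X : Type) (w : X) : 0 <= (cst 1 w : \bar R) <= 1 by rewrite /= lee01 lexx.
rewrite (@laplace_next_generation _ _ _ _ _ P E 0 nu (fun _ z => rho z.2)
  _ _ _ _ (pois 0%N) (cst 1) F)//.
- apply: eq_integral => w _; rewrite mul1e /rhs; congr (expeR (- _)).
  rewrite generation0 esum_set1.
    apply: eq_integral => z _; rewrite /F expeRN_lne//.
    by have /andP[] := G01 n ((t - z.1)%R, z.2).
  apply: integral_ge0 => z _; rewrite mule_ge0// subre_ge0// expeRN_le1//.
- by move=> u _; exact: measurableT_comp.
- by move=> u w C; rewrite generation0 => ->; exact: nu0.
Qed.

End laplace_limits.

(** * The data of the Hawkes process *)

Lemma measurable_I01 {R : realType} : measurable (@I01 R).
Proof. exact: measurable_itv. Qed.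

Section zero_extension.
Context {R : realType} {dM : measure_display} {M : measurableType dM}.
Variables (B : M -> R -> R -> R) (W : R -> R -> R) (h : R -> R).
Hypotheses (h0 : forall t : R, (0 <= t)%R -> (0 <= h t)%R)
  (mh : measurable_fun ([set` `[0%R, +oo[] : set R) h)
  (W0 : forall x y, I01 x -> I01 y -> (0 <= W x y)%R)
  (mW : measurable_fun (I01 `*` I01) (fun z : R * R => W z.1 z.2))
  (B0 : forall m x y, I01 x -> I01 y -> (0 <= B m x y)%R)
  (mB : measurable_fun (setT `*` (I01 `*` I01))
          (fun z : M * (R * R) => B z.1 z.2.1 z.2.2)).

Let B' := (fun z : M * (R * R) => B z.1 z.2.1 z.2.2) \_ (setT `*` (I01 `*` I01)).
Let W' := (fun z : R * R => W z.1 z.2) \_ (I01 `*` I01).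
Let h' := h \_ [set` `[0%R, +oo[].

(** The argument is ((mark, location of the parent), (age of the parent, location of the child)).
    The data are controlled only for locations in [0, 1] and ages in [0, +oo[; their extensions by
    zero are measurable and nonnegative everywhere. *)
Definition birth_rate (z : (M * R) * (R * R)) : R :=
  (B' (z.1.1, (z.2.2, z.1.2)) * W' (z.2.2, z.1.2) * h' z.2.1)%R.

Lemma measurable_birth_rate : measurable_fun setT birth_rate.
Proof.
have mI2 : measurable (@I01 R `*` @I01 R).
  by apply: measurableX; exact: measurable_I01.
have mB' : measurable_fun setT B'.
  by apply/(measurable_restrictT _ _).1 => //; exact: measurableX.
have mW' : measurable_fun setT W' by apply/(measurable_restrictT _ _).1.
have mh' : measurable_fun setT h' by apply/(measurable_restrictT _ _).1.
have m11 : measurable_fun [set: (M * R) * (R * R)] (fun z => z.1.1).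
  exact: measurableT_comp.
have m12 : measurable_fun [set: (M * R) * (R * R)] (fun z => z.1.2).
  exact: measurableT_comp.
have m21 : measurable_fun [set: (M * R) * (R * R)] (fun z => z.2.1).
  exact: measurableT_comp.
have m22 : measurable_fun [set: (M * R) * (R * R)] (fun z => z.2.2).
  exact: measurableT_comp.
apply: measurable_funM; [apply: measurable_funM|].
- apply: (measurableT_comp mB'); apply: measurable_fun_pair => //.
  exact: measurable_fun_pair.
- by apply: (measurableT_comp mW'); exact: measurable_fun_pair.
- exact: (measurableT_comp mh').
Qed.

Lemma birth_rate_ge0 z : (0 <= birth_rate z)%R.
Proof.
apply: mulr_ge0; [apply: mulr_ge0|].
- rewrite /B' patchE; case: ifPn => // /set_mem[_ [/= ? ?]]; exact: B0.
- by rewrite /W' patchE; case: ifPn => // /set_mem[/= ? ?]; exact: W0.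
- rewrite /h' patchE; case: ifPn => // /set_mem/=; rewrite in_itv/= andbT.
  exact: h0.
Qed.

Lemma birth_rate_lt0 a v x : (v < 0)%R -> birth_rate (a, (v, x)) = 0%R.
Proof.
move=> v0; rewrite /birth_rate /= /h' [X in (_ * X)%R]patchE memNset ?mulr0//=.
by rewrite in_itv/= andbT leNgt v0.
Qed.

Lemma birth_rateE m y v x : I01 y -> birth_rate ((m, y), (v, x)) =
  if (v, x) \in [set` `[0%R, +oo[] `*` I01 then (B m x y * W x y * h v)%R else 0%R.
Proof.
move=> y01; rewrite /birth_rate /= /B' /W' /h' !patchE !in_setX/=.
rewrite in_setT (mem_set y01) !andbT andTb.
case: (x \in I01); last by rewrite mul0r mul0r andbF.
by rewrite andbT; case: ifP => _ //; rewrite mulr0.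
Qed.

(** By [loc_I01] a born parent lies in [0, 1], so the extension by zero only encodes the restriction
    of the child to later times and to [0, 1]. *)
Lemma offspring_intensityE {dT : measure_display} {T : measurableType dT}
    (E : events T M R) u w C : measurable C ->
  offspring_intensity h W B E u w C =
  \int[leb R \x leb R]_(z in C) offspring_rate E birth_rate u w z.
Proof.
move=> mC; rewrite /offspring_intensity /offspring_rate.
case: ifP => bu; last by rewrite integral0.
rewrite integral_mkcondr; apply: eq_integral => z _.
rewrite patchE birth_rateE; last exact: (loc_I01 bu).
have e : (z \in [set` `[time E u w, +oo[] `*` I01) =
    ((z.1 - time E u w, z.2)%R \in [set` `[0%R, +oo[] `*` I01).
  apply/idP/idP; rewrite !inE/= !in_itv/= !andbT => -[? ?]; split=> //; lra.
by rewrite e; case: ifP.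
Qed.

End zero_extension.

Section lifetime_law.
Context {R : realType} {dJ : measure_display} {V : measurableType dJ}.
Variables (PJ : probability V R) (J : R -> V -> R).

Let J' (x : R) : V -> R := if x \in I01 then J x else cst 0%R.

(** Outside [0, 1] the lifetime is taken to be 0, which gives a probability for every real x. The
    measurability proofs are arguments so that the measure and kernel structures can be attached to
    the term. *)
Definition lifetime_law
    (mJ : forall x, I01 x -> measurable_fun setT (J x))
    (mlaw : forall C : set R, measurable C ->
      measurable_fun I01 (fun x : R => PJ (J x @^-1` C)))
    (x : R) (C : set R) : \bar R := PJ (J' x @^-1` C).

Hypotheses (mJ : forall x, I01 x -> measurable_fun setT (J x))
  (mlaw : forall C : set R, measurable C ->
     measurable_fun I01 (fun x : R => PJ (J x @^-1` C))).

Let mJ' x : measurable_fun setT (J' x).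
Proof. by rewrite /J'; case: ifPn => // /set_mem; exact: mJ. Qed.

Let mpre x C : measurable C -> measurable (J' x @^-1` C).
Proof. by move=> mC; rewrite -[X in measurable X]setTI; exact: mJ'. Qed.

Let law0 x : lifetime_law mJ mlaw x set0 = 0.
Proof. by rewrite /lifetime_law preimage_set0 measure0. Qed.

Let law_ge0 x C : 0 <= lifetime_law mJ mlaw x C.
Proof. exact: measure_ge0. Qed.

Let law_sigma_additive x : semi_sigma_additive (lifetime_law mJ mlaw x).
Proof.
move=> F mF tF mUF; rewrite /lifetime_law preimage_bigcup.
apply: measure_semi_sigma_additive.
- by move=> n; exact: mpre.
- apply/trivIsetP => i j _ _ ij; rewrite -preimage_setI.
  by move/trivIsetP : tF => ->//; rewrite preimage_set0.
- by rewrite -preimage_bigcup; exact: mpre.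
Qed.

HB.instance Definition _ x := isMeasure.Build _ _ _ (lifetime_law mJ mlaw x)
  (law0 x) (law_ge0 x) (@law_sigma_additive x).

Definition lifetime_kernel (x : R) : {measure set R -> \bar R} :=
  lifetime_law mJ mlaw x.

Let measurable_law C : measurable C -> measurable_fun setT (lifetime_kernel ^~ C).
Proof.
move=> mC.
rewrite [X in measurable_fun _ X](_ : _ = fun x => if x \in I01
    then ((fun x => PJ (J x @^-1` C)) \_ I01) x else PJ (cst 0%R @^-1` C)).
  apply: measurable_fun_ifT => //; last first.
    apply/(measurable_restrictT _ _).1; [exact: measurable_I01|exact: mlaw].
  apply: (measurable_fun_bool true); rewrite setTI.
  rewrite (_ : _ @^-1` _ = I01); first exact: measurable_I01.
  by apply/seteqP; split=> x /= => [/set_mem|/mem_set].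
apply/funext => x; rewrite /lifetime_kernel/= /lifetime_law /J' patchE.
by case: ifP.
Qed.

HB.instance Definition _ := isKernel.Build _ _ _ _ _ lifetime_kernel measurable_law.

Let law_prob x : lifetime_kernel x setT = 1.
Proof.
rewrite /lifetime_kernel/= /lifetime_law preimage_setT; exact: probability_setT.
Qed.

HB.instance Definition _ := Kernel_isProbability.Build _ _ _ _ _
  lifetime_kernel law_prob.

Lemma lifetime_kernelE x C : I01 x -> lifetime_kernel x C = PJ (J x @^-1` C).
Proof. by move=> x01; rewrite /lifetime_kernel/= /lifetime_law /J' mem_set. Qed.

End lifetime_law.

(** * Passage to the limit and identification of the two sides *)

Theorem theorem7 (R : realType)
  (lam h : R -> R) (W : R -> R -> R)
  (dM : measure_display) (M : measurableType dM) (PB : probability M R)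
  (B : M -> R -> R -> R)
  (dJ : measure_display) (V : measurableType dJ) (PJ : probability V R)
  (J : R -> V -> R)
  (p q : \bar R)
  (lam_ge0 : forall x, I01 x -> (0 <= lam x)%R)
  (lam_L1 : (leb R).-integrable I01 (EFin \o lam))
  (h_ge0 : forall t : R, (0 <= t)%R -> (0 <= h t)%R)
  (h_L1 : (leb R).-integrable [set` `[0%R, +oo[] (EFin \o h))
  (W_ge0 : forall x y, I01 x -> I01 y -> (0 <= W x y)%R)
  (W_meas : measurable_fun (I01 `*` I01) (fun z : R * R => W z.1 z.2))
  (B_ge0 : forall m x y, I01 x -> I01 y -> (0 <= B m x y)%R)
  (B_meas : measurable_fun (setT `*` (I01 `*` I01))
              (fun z : M * (R * R) => B z.1 z.2.1 z.2.2))
  (B_sep : separable_process PB (I01 `*` I01)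
             (fun (z : R * R) m => B m z.1 z.2))
  (p_ge1 : 1 <= p) (q_ge1 : 1 <= q) (pq : p^-1 + q^-1 = 1)
  (WB_Lpq : {ae leb R, forall y, I01 y ->
     'N[leb R]_p[(fun x => (W x y)%:E) \_ I01] < +oo /\
     'N[leb R]_q[(fun x => 'E_PB[fun m => B m x y]) \_ I01] < +oo})
  (J_ge0 : forall x v, I01 x -> (0 <= J x v)%R)
  (J_meas : forall x, I01 x -> measurable_fun setT (J x))
  (J_sep : separable_process PJ I01 J)
  (J_law_meas : forall C : set R, measurable C ->
     measurable_fun I01 (fun x : R => PJ (J x @^-1` C)))
  (dQ : measure_display) (TQ : measurableType dQ) (PQ : probability TQ R)
  (Q : events TQ M R)
  (Q_hawkes : hawkes_process PQ PB PJ lam h W B J Q)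
  (dS : measure_display) (TS : R -> measurableType dS)
  (PS : forall x, probability (TS x) R)
  (S : forall x, events (TS x) M R)
  (S_cluster : forall x, I01 x -> cluster_process (PS x) PB PJ h W B J x (S x))
  (t : R) (t_ge0 : (0 <= t)%R)
  (f : R -> R)
  (f_ge0 : forall x, I01 x -> (0 <= f x)%R)
  (f_bnd : [bounded f x | x in I01])
  (f_meas : measurable_fun I01 f) :
  let eta x u := laplace (PS x) (S x) f u in
  laplace PQ Q f t =
  expeR (\int[leb R]_(x in I01) \int[leb R]_(u in [set` `[0%R, t]])
           ((eta x u - 1) * (lam x)%:E)).
Proof.
move=> eta.
(* A version of [f] that is measurable and nonnegative on the whole line and agrees with [f] on
   [0, 1], where the born events are. *)
pose fR (x : R) : R := Num.max ((f \_ I01) x) 0%R.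
have mfR : measurable_fun setT fR.
  apply: measurable_maxr => //.
  by apply/(measurable_restrictT _ _).1 => //; exact: measurable_I01.
have fR0 x : (0 <= fR x)%R by rewrite le_max lexx orbT.
have fE x : I01 x -> f x = fR x.
  move=> x01; rewrite /fR patchE mem_set//; apply/esym/max_idPl.
  exact: f_ge0.
pose law : R.-pker R ~> R := lifetime_kernel J_meas J_law_meas.
have lawE x C : I01 x -> measurable C -> law x C = PJ (J x @^-1` C).
  by move=> x01 _; exact: lifetime_kernelE.
have mh : measurable_fun ([set` `[0%R, +oo[] : set R) h.
  by apply/measurable_EFinP; exact: measurable_int h_L1.
pose rate := birth_rate B W h.
have mrate : measurable_fun setT rate by exact: measurable_birth_rate.
have rate0 z : (0 <= rate z)%R by exact: birth_rate_ge0.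
pose g := survival law fR.
have mg : measurable_fun setT g by exact: measurable_survival.
have g01 z : 0 <= g z <= 1 by exact: survival_itv01.
pose G n := generation_iter PB rate g n.
have mG n : measurable_fun setT (G n).
  by have [] := generation_iter_prop PB mrate rate0 mg g01 n.
have G01 n z : 0 <= G n z <= 1.
  by have [_] := generation_iter_prop PB mrate rate0 mg g01 n.
have niG z : nonincreasing_seq (G ^~ z).
  exact: nonincreasing_generation_iter.
pose Ginf z := limn (G ^~ z).
have cG z : G n z @[n --> \oo] --> Ginf z.
  exact: ereal_nonincreasing_is_cvgn.
have mGinf : measurable_fun setT Ginf.
  by apply: (emeasurable_fun_cvg G) => // z _; exact: cG.
have Ginf01 z : 0 <= Ginf z <= 1.
  apply/andP; split.
    by apply: lime_ge; [exact: cG|apply: nearW => n; have /andP[] := G01 n z].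
  by apply: lime_le; [exact: cG|apply: nearW => n; have /andP[] := G01 n z].
have Ginf_lt0 r x : (r < 0)%R -> Ginf (r, x) = 1.
  move=> r0; apply/cvg_lim => //.
  rewrite (_ : (fun n => _) = cst 1); first exact: cvg_cst.
  apply/funext => n; apply: generation_iter_lt0 => //.
  - by move=> a v y v0; exact: birth_rate_lt0.
  - by move=> s y s0; exact: survival_lt0.
have etaE x u : I01 x -> eta x u = Ginf (u, x).
  move=> x01; have [root rep mk lt] := S_cluster x x01.
  rewrite /eta (laplace_survival u lawE mfR fR0 fE lt).
  have := @cvg_laplace_before _ _ _ _ _ (PS x) (S x) g u mg g01.
  (* The n-th iterate belongs to words of length at most n, that is to [before n.+1], hence the
     shift by one. The Hawkes process below needs two, its immigrants having length 1. *)
  rewrite -cvg_shiftS => c1; apply/esym/cvg_lim => //.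
  apply: cvg_trans c1; apply: near_eq_cvg; apply: nearW => n /=.
  apply: (cluster_laplace_before u mrate rate0 mg g01 mk n root rep).
  by move=> v w C; exact: offspring_intensityE.
have [rootQ repQ mkQ ltQ] := Q_hawkes.
have lam_int : measurable_fun I01 (EFin \o lam) by exact: measurable_int lam_L1.
pose lamI := (EFin \o lam) \_ I01.
have mlamI : measurable_fun setT lamI.
  by apply/(measurable_restrictT _ _).1 => //; exact: measurable_I01.
have lamI0 x : 0 <= lamI x.
  by rewrite /lamI patchE; case: ifPn => // /set_mem x01; rewrite lee_fin lam_ge0.
pose rho (z : R * R) : \bar R := if (0 <= z.1)%R then lamI z.2 else 0.
have mrho : measurable_fun setT rho.
  apply: measurable_fun_ifT => //; first exact: measurable_fun_ler.
  exact: measurableT_comp.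
have rho0 z : 0 <= rho z by rewrite /rho; case: ifP.
have rho_fin z : rho z \is a fin_num.
  by rewrite /rho /lamI patchE; case: ifP => // _; case: ifP.
pose a n := \int[leb R \x leb R]_z ((1 - G n ((t - z.1)%R, z.2)) * rho z).
have laplace_before n :
    \int[PQ]_w expeR (- \esum_(u in before n.+2) score Q t g u w) = expeR (- a n).
  apply: (hawkes_laplace_before t mrate rate0 mg g01 mkQ n mrho rho0 rho_fin
    rootQ repQ).
  - move=> w C mC; rewrite /immigrant_intensity integral_mkcondr.
    apply: eq_integral => z _; rewrite patchE in_setX /rho /lamI patchE.
    rewrite (_ : (z.1 \in _) = (0 <= z.1)%R).
      by case: (0 <= z.1)%R; case: (z.2 \in I01).
    by apply/idP/idP; rewrite inE/= in_itv/= andbT.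
  - by move=> [//|i u] w C _ mC; exact: offspring_intensityE.
pose ainf := \int[leb R \x leb R]_z ((1 - Ginf ((t - z.1)%R, z.2)) * rho z).
have m1G (F : R * R -> \bar R) : measurable_fun setT F ->
    measurable_fun [set: R * R] (fun z => (1 - F ((t - z.1)%R, z.2)) * rho z).
  move=> mF; apply: emeasurable_funM => //; apply: emeasurable_funB => //.
  apply: measurableT_comp => //; apply: measurable_fun_pair => //.
  exact: measurable_funB.
have nda z : nondecreasing_seq (fun n => (1 - G n ((t - z.1)%R, z.2)) * rho z).
  by move=> m n mn; rewrite lee_wpmul2r// leeB//; exact: niG.
have one_sub (F : R * R -> \bar R) z : (forall z, 0 <= F z <= 1) -> 0 <= 1 - F z.
  by move=> F01; rewrite subre_ge0//; have /andP[] := F01 z.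
have ca : a n @[n --> \oo] --> ainf.
  rewrite [X in _ --> X](_ : _ = \int[leb R \x leb R]_z
      limn (fun n => (1 - G n ((t - z.1)%R, z.2)) * rho z)).
    apply: cvg_monotone_convergence => //.
    - by move=> n; exact: (m1G _ (mG n)).
    - by move=> n z _; rewrite mule_ge0// one_sub.
  apply: eq_integral => z _; apply/esym/cvg_lim => //.
  by apply: cvgeZr => //; apply: cvgeB => //; exact: cvg_cst.
have laplaceQ : laplace PQ Q f t = expeR (- ainf).
  rewrite (laplace_survival t lawE mfR fR0 fE ltQ).
  have := @cvg_laplace_before _ _ _ _ _ PQ Q g t mg g01.
  rewrite -cvg_shiftS -cvg_shiftS => c1; apply: (cvg_unique _ c1) => //.
  rewrite (_ : [sequence _]_n = fun n => expeR (- a n)); last exact/funext.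
  apply: cvg_expeRN => // m n mn; apply: ge0_le_integral => //.
  - by move=> z _; rewrite mule_ge0// one_sub.
  - exact: (m1G _ (mG m)).
  - exact: (m1G _ (mG n)).
  - by move=> z _; exact: nda.
rewrite laplaceQ; congr expeR.
(* In the variable u = t - s, the age at time t of an immigrant born at s, the integrand involves
   Ginf (u, x), which is [eta x u]. *)
pose k (z : R * R) := (1 - Ginf z) * rho ((t - z.1)%R, z.2).
have mk : measurable_fun setT k.
  apply: emeasurable_funM; first exact: emeasurable_funB.
  apply: measurableT_comp => //; apply: measurable_fun_pair => //.
  exact: measurable_funB.
have k0 z : 0 <= k z by rewrite mule_ge0// one_sub.
have -> : ainf = \int[leb R]_(x in I01) \int[leb R]_(u in [set` `[0%R, t]])
    ((1 - Ginf (u, x)) * (lam x)%:E).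
  transitivity (\int[leb R \x leb R]_z k z).
    rewrite -(ge0_integral_reflect2 t mk k0); apply: eq_integral => z _.
    by rewrite /k /= subKr; case: z.
  transitivity (\int[leb R]_x \int[leb R]_u k (u, x)).
    exact: (fubini_tonelli2 (m1 := leb R) (m2 := leb R) k).
  rewrite [RHS]integral_mkcond; apply: eq_integral => x _; rewrite patchE.
  case: ifPn => [x01|x01]; last first.
    apply: integral0_eq => u _; rewrite /k /rho /lamI /= patchE (negbTE x01).
    by case: ifP => _; rewrite mule0.
  rewrite [RHS]integral_mkcond; apply: eq_integral => u _; rewrite patchE.
  rewrite /k /rho /lamI /= patchE x01 subr_ge0.
  rewrite (_ : (u \in _) = (0 <= u <= t)%R); last first.
    by apply/idP/idP; rewrite inE/= in_itv.
  (* Two different reasons bound the range of u: for u > t the immigrant would precede time 0 and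
     [rho] vanishes; for u < 0 it comes after t and [Ginf] is 1. *)
  have [u0|u0] /= := leP 0%R u; first by case: ifP => //; rewrite mule0.
  by rewrite Ginf_lt0// subee// mul0e.
have lamx0 x u : I01 x -> 0 <= (1 - Ginf (u, x)) * (lam x)%:E.
  by move=> x01; rewrite mule_ge0 ?one_sub// lee_fin lam_ge0.
(* The limit produces the nonnegative integrand 1 - Ginf; nonnegativity allows the sign to be
   carried inside both integrals, infinite values included. *)
rewrite -integral_ge0N; last first.
  by move=> x x01; apply: integral_ge0 => u _; exact: lamx0.
apply: eq_integral => x /set_mem x01; rewrite -integral_ge0N; last first.
  by move=> u _; exact: lamx0.
apply: eq_integral => u _; rewrite etaE// -mulNe; congr (_ * _).
have /andP[Gi0 Gi1] := Ginf01 (u, x).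
have Gfin : Ginf (u, x) \is a fin_num by rewrite ge0_fin_numE// (le_lt_trans Gi1)// ltry.
by rewrite fin_num_oppeB// addeC.
Qed.
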